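(* Let $(\mathfrak c,\pi_{\mathfrak c})$ be a cover which is canonical and respects symbol expansion. If $X_1$ and $X_2$ are flow equivalent irreducible sofic shifts, then the two factor maps $\pi_{\mathfrak c(X_1)}$ and $\pi_{\mathfrak c(X_2)}$ are flow equivalent factor maps.
   Context: A shift space is a closed shift-invariant subset of $\mathfrak a^{\mathbb Z}$ ($\mathfrak a$ finite), with the shift $\sigma$; $\mathfrak a(X)$ denotes the alphabet of $X$. A factor map is a surjective sliding block code. A one-block code is one induced by a map of alphabets. Mapping torus: $\mathsf{S}X=(X\times\mathbb R)/{\sim}$, where $(x,t)\sim(y,s)$ iff $t-s\in\mathbb Z$ and $y=\sigma^{t-s}(x)$, with flow $\gamma_{t_0}([x,t])=[x,t+t_0]$. A flow equivalence $\psi\colon\mathsf{S}X\to\mathsf{S}X'$ is a homeomorphism such that for each $x\in\mathsf{S}X$ there is an increasing $f_x\colon\mathbb R\to\mathbb R$ with $\psi(\gamma_t(x))=\gamma_{f_x(t)}(\psi(x))$; shift spaces are flow equivalent if such $\psi$ exists. For a sliding block code $f\colon Y\to X$, $\mathsf{S}f([y,t])=[f(y),t]$. Codes $f\colon Y\to X$ and $f'\colon Y'\to X'$ are flow equivalent if there are flow equivalences $\psi\colon\mathsf{S}Y\to\mathsf{S}Y'$, $\phi\colon\mathsf{S}X\to\mathsf{S}X'$ with $\phi\circ\mathsf{S}f=\mathsf{S}f'\circ\psi$. Symbol expansion: for $X\subseteq\mathfrak a^{\mathbb Z}$ and $A\subseteq\mathfrak a$ choose new symbols $\star_a\notin\mathfrak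 a$ ($a\in A$, distinct). Let $\iota_A$ map $\dots a_{-1}.a_0a_1\dots$ to $\dots\tilde a_{-1}.\tilde a_0\tilde a_1\dots$ with $\tilde a=a$ if $a\notin A$ and $\tilde a=a\star_a$ if $a\in A$. Put $\mathfrak e_A(X)=\iota_A(X)\cup\sigma(\iota_A(X))$, and $\mathfrak e_a=\mathfrak e_{\{a\}}$. If $\pi\colon Y\to X$ is a one-block factor map induced by $\mathcal L\colon\mathfrak a(Y)\to\mathfrak a(X)$, $A\subseteq\mathfrak a(X)$ and $\tilde A=\mathcal L^{-1}(A)$, then $\mathfrak e_A(\pi)\colon\mathfrak e_{\tilde A}(Y)\to\mathfrak e_A(X)$ is the one-block map induced by $c\mapsto\mathcal L(c)$ for $c\in\mathfrak a(Y)$ and $\star_b\mapsto\star_{\mathcal L(b)}$ for $b\in\tilde A$; $\mathfrak e_a(\pi)=\mathfrak e_{\{a\}}(\pi)$. A cover $(\mathfrak c,\pi_{\mathfrak c})$ associates to each irreducible sofic shift $X$ an irreducible shift of finite type $\mathfrak c(X)$ and a factor map $\pi_{\mathfrak c(X)}\colon\mathfrak c(X)\to X$. It is canonical if for every conjugacy $\phi\colon X_1\to X_2$ of irreducible sofic shifts there is a unique conjugacy $\mathfrak c(\phi)\colon\mathfrak c(X_1)\to\mathfrak c(X_2)$ with $\pi_{\mathfrak c(X_2)}\circ\mathfrak c(\phi)=\phi\circ\pi_{\mathfrak c(X_1)}$. It respects symbol expansion if every $\pi_{\mathfrak c(X)}$ is a one-block code, and for every irreducible sofic $X$ and $a\in\mathfrak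 a(X)$, with $A$ the set of symbols of $\mathfrak a(\mathfrak c(X))$ mapped to $a$, there is a conjugacy $\phi\colon\mathfrak c(\mathfrak e_a(X))\to\mathfrak e_A(\mathfrak c(X))$ with $\mathfrak e_a(\pi_{\mathfrak c(X)})\circ\phi=\pi_{\mathfrak c(\mathfrak e_a(X))}$. *)

(* Defs.v *)
From HB Require Import structures.
From mathcomp Require Import all_boot all_order all_algebra.
From mathcomp Require Import all_classical all_reals all_analysis.

Set Implicit Arguments.
Unset Strict Implicit.
Unset Printing Implicit Defensive.

Import Order.TTheory GRing.Theory Num.Theory.
Import numFieldNormedType.Exports.
Local Open Scope classical_set_scope.
Local Open Scope ring_scope.
Local Open Scope quotient_scope.

Definition config (A : finType) : Type :=
  prod_topology (fun _ : int => discrete_topology A).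

(* [shiftn n] is the n-th power of the shift map sigma = [shiftn 1]. *)
Definition shiftn (A : finType) (n : int) (x : config A) : config A :=
  fun i => x (i + n).

Record shift_space := ShiftSpace {
  alphabet : finType;
  points :> set (config alphabet);
  shift_closed : closed points;
  shift_invariant : shiftn 1 @` points = points }.

Arguments points : clear implicits.

Definition word (A : finType) (x : config A) (i : int) (n : nat) : seq A :=
  [seq x (i + k%:Z) | k <- iota 0 n].

Definition blocks (X : shift_space) (n : nat) : set (seq (alphabet X)) :=
  [set w | exists (x : X) (i : int), w = word (val x) i n].

Arguments blocks : clear implicits.

Definition language (X : shift_space) : set (seq (alphabet X)) :=
  [set w | blocks X (size w) w].

Arguments language : clear implicits.

Lemma block_atP (X : shift_space) (n : nat) (x : X) (i : int) :
  word (val x) i n \in blocks X n.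
Proof. by apply/mem_set; exists x, i. Qed.

Definition block_at (X : shift_space) (n : nat) (x : X) (i : int) :
  blocks X n := exist _ (word (val x) i n) (block_atP n x i).

Definition irreducible_shift (X : shift_space) : Prop :=
  forall u v, language X u -> language X v ->
  exists w, language X (u ++ w ++ v).

Definition shift_of_finite_type (X : shift_space) : Prop :=
  exists F : seq (seq (alphabet X)), points X =
    [set x | forall (i : int) w, w \in F -> word x i (size w) <> w].

Definition sliding_block_code (Y X : shift_space) (f : Y -> X) : Prop :=
  exists (m n : nat) (Phi : blocks Y (m + n).+1 -> alphabet X),
  forall (y : Y) (i : int),
    val (f y) i = Phi (block_at (m + n).+1 y (i - m%:Z)).

Definition factor_map (Y X : shift_space) (f : Y -> X) : Prop :=
  sliding_block_code f /\ (forall x, exists y, f y = x).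

Definition conjugacy (Y X : shift_space) (f : Y -> X) : Prop :=
  sliding_block_code f /\
  exists g : X -> Y, [/\ sliding_block_code g, cancel f g & cancel g f].

Definition one_block (Y X : shift_space) (L : alphabet Y -> alphabet X)
  (f : Y -> X) : Prop := forall (y : Y) (i : int), val (f y) i = L (val y i).

Definition sofic (X : shift_space) : Prop :=
  exists (Y : shift_space) (f : Y -> X), shift_of_finite_type Y /\ factor_map f.

Lemma shiftD (A : finType) (m n : int) (x : config A) :
  shiftn m (shiftn n x) = shiftn (m + n) x.
Proof. by apply/funext => i; rewrite /shiftn addrA. Qed.

Lemma shift0 (A : finType) (x : config A) : shiftn 0 x = x.
Proof. by apply/funext => i; rewrite /shiftn addr0. Qed.

Section MappingTorus.
Variables (R : realType) (X : shift_space).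

Definition torus_rel : rel (X * R) := fun p q =>
  `[< exists n : int, p.2 - q.2 = n%:~R /\ val q.1 = shiftn n (val p.1) >].

Lemma torus_rel_refl : reflexive torus_rel.
Proof. by move=> p; apply/asboolP; exists 0; rewrite subrr shift0. Qed.

Lemma torus_rel_sym : symmetric torus_rel.
Proof.
have H p q : torus_rel p q -> torus_rel q p.
  move=> /asboolP[n [en eqp]]; apply/asboolP; exists (- n).
  by rewrite eqp shiftD addNr shift0 -opprB en rmorphN.
by move=> p q; apply/idP/idP; exact: H.
Qed.

Lemma torus_rel_trans : transitive torus_rel.
Proof.
move=> q p r /asboolP[n [en eqp]] /asboolP[m [em erq]].
apply/asboolP; exists (m + n); rewrite erq eqp shiftD; split => //.
by rewrite rmorphD/= -en -em [RHS]addrC subrKA.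
Qed.

Canonical torus_equiv :=
  EquivRel torus_rel torus_rel_refl torus_rel_sym torus_rel_trans.

Definition torus : Type := quotient_topology {eq_quot torus_equiv}.

Definition torus_class (x : X) (t : R) : torus := \pi_torus (x, t).

Lemma torus_classP (x y : X) (s t : R) :
  torus_class x t = torus_class y s <->
  exists n : int, t - s = n%:~R /\ val y = shiftn n (val x).
Proof.
rewrite /torus_class; split=> [/eqmodP/asboolP//|H].
by apply/eqmodP/asboolP.
Qed.

Definition flow (t : R) (p : torus) : torus :=
  torus_class (repr p).1 ((repr p).2 + t).

Lemma flowE (x : X) (s t : R) :
  flow t (torus_class x s) = torus_class x (s + t).
Proof.
rewrite /flow; set p := repr _.
have /torus_classP[n [en ex]] : torus_class p.1 p.2 = torus_class x s.
  by rewrite {1}/torus_class -surjective_pairing reprK.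
by apply/torus_classP; exists n; split=> //; rewrite -en [s + t]addrC addrKA.
Qed.

End MappingTorus.

Arguments torus_class {R X} x t.
Arguments flow {R X} t p.

Definition torus_map (R : realType) (Y X : shift_space) (f : Y -> X)
  (p : torus R Y) : torus R X := torus_class (f (repr p).1) (repr p).2.

Lemma sliding_block_code_shift (Y X : shift_space) (f : Y -> X) :
  sliding_block_code f -> forall (y z : Y) (n : int),
  val z = shiftn n (val y) -> val (f z) = shiftn n (val (f y)).
Proof.
move=> [m [k [Phi fE]]] y z n zE; apply/funext => i.
rewrite /shiftn !fE; congr (Phi _); apply/val_inj => /=.
by rewrite zE; apply: eq_map => j; rewrite /shiftn addrAC [i - _ + _]addrAC.
Qed.

Lemma torus_mapE (R : realType) (Y X : shift_space) (f : Y -> X) :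
  sliding_block_code f -> forall (y : Y) (t : R),
  torus_map f (torus_class y t) = torus_class (f y) t.
Proof.
move=> fP y t; rewrite /torus_map; set p := repr _.
have /torus_classP[n [en ex]] : torus_class p.1 p.2 = torus_class y t.
  by rewrite {1}/torus_class -surjective_pairing reprK.
apply/torus_classP; exists n; split=> //.
exact: sliding_block_code_shift ex.
Qed.

Definition homeomorphism (S T : topologicalType) (f : S -> T) : Prop :=
  continuous f /\
  exists g : T -> S, [/\ continuous g, cancel f g & cancel g f].

Definition flow_equivalence (R : realType) (X Y : shift_space)
  (psi : torus R X -> torus R Y) : Prop :=
  homeomorphism psi /\
  forall p, exists f : R -> R,
    {homo f : s t / s < t} /\ forall t, psi (flow t p) = flow (f t) (psi p).

Definition flow_equivalent (R : realType) (X Y : shift_space) : Prop :=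
  exists psi : torus R X -> torus R Y, flow_equivalence psi.

Definition flow_equivalent_codes (R : realType) (Y X Y' X' : shift_space)
  (f : Y -> X) (f' : Y' -> X') : Prop :=
  exists (psi : torus R Y -> torus R Y') (phi : torus R X -> torus R X'),
    [/\ flow_equivalence psi, flow_equivalence phi &
        phi \o torus_map f = torus_map f' \o psi].

(* In the alphabet of an expansion, [inl a] is the old symbol a, and [inr s] is
   the new symbol star_(val s). *)
Definition expand_alphabet (A : finType) (P : pred A) : finType :=
  (A + {a : A | P a})%type.

Definition tilde (A : finType) (P : pred A) (a : A) :
  seq (expand_alphabet P) :=
  inl a :: (if insub a is Some s then [:: inr s] else [::]).

(* The n-th symbol of w_0 w_1 w_2 ..., for nonempty words w_k. *)
Definition concat_nth (T : Type) (d : T) (w : nat -> seq T) (n : nat) : T :=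
  nth d (flatten [seq w k | k <- iota 0 n.+1]) n.

(* The map iota_P. Since [Negz n] is -(n+1), the left half is the infinite word
   rev ~x_{-1} rev ~x_{-2} ... read leftwards from coordinate -1. *)
Definition expand_config (A : finType) (P : pred A) (x : config A) :
  config (expand_alphabet P) := fun j =>
  match j with
  | Posz n => concat_nth (inl (x 0)) (fun k => tilde P (x k%:Z)) n
  | Negz n => concat_nth (inl (x 0)) (fun k => rev (tilde P (x (Negz k)))) n
  end.

Lemma continuous_prod_topology (I : Type) (K : I -> topologicalType)
    (T : topologicalType) (f : T -> prod_topology K) :
  (forall i, continuous (fun x => f x i)) -> continuous f.
Proof.
move=> fc x; apply/cvg_sup => i U [_ [[V oV <-] Vfx sVU]].
apply: filterS sVU _; apply: fc; exact: open_nbhs_nbhs.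
Qed.

Lemma locally_constant_continuous (T : topologicalType)
    (D : discreteTopologicalType) (f : T -> D) :
  (forall x, nbhs x [set y | f y = f x]) -> continuous f.
Proof. by move=> fc x; apply/discrete_cvg; exact: fc. Qed.

Section Expand.
Variables (A : finType) (P : pred A).
Implicit Types x : config A.

Lemma size_flatten_iota (T : Type) (w : nat -> seq T) i n :
  (forall k, 0 < size (w k))%N ->
  (n <= size (flatten [seq w k | k <- iota i n]))%N.
Proof.
move=> w0; elim: n i => //= n IHn i; rewrite size_cat.
by rewrite -add1n leq_add.
Qed.

Lemma concat_nthE (T : Type) (d d' : T) (w : nat -> seq T) n m :
  (forall k, 0 < size (w k))%N -> (n < m)%N ->
  concat_nth d w n = nth d' (flatten [seq w k | k <- iota 0 m]) n.
Proof.
move=> w0 nm; rewrite /concat_nth -(subnKC nm) iotaD map_cat flatten_cat nth_cat.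
have sz : (n < size (flatten [seq w k | k <- iota 0 n.+1]))%N.
  exact: size_flatten_iota.
by rewrite sz; apply: set_nth_default.
Qed.

Lemma concat_nth_cons (T : Type) (d d' : T) (w : nat -> seq T) n :
  (forall k, 0 < size (w k))%N ->
  concat_nth d w n = if (n < size (w 0))%N then nth d' (w 0) n else
    concat_nth d' (fun k => w k.+1) (n - size (w 0)).
Proof.
move=> w0; rewrite (concat_nthE d d' (m := n.+2))//.
have -> : iota 0 n.+2 = 0%N :: [seq k.+1 | k <- iota 0 n.+1].
  by rewrite -(iotaDl 1 0).
rewrite map_cons -map_comp nth_cat; case: ifP => // _.
by rewrite (concat_nthE _ d' (m := n.+1))// ltnS leq_subr.
Qed.

Lemma eq_concat_nth (T : Type) (d d' : T) (w w' : nat -> seq T) n :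
  (forall k, 0 < size (w k))%N -> (forall k, (k <= n)%N -> w k = w' k) ->
  concat_nth d w n = concat_nth d' w' n.
Proof.
move=> w0 ww'; rewrite (concat_nthE d d' (m := n.+1))// /concat_nth.
congr (nth _ (flatten _) _); apply/eq_in_map => k.
by rewrite mem_iota add0n ltnS; exact: ww'.
Qed.

Lemma concat_nth_map (T T' : Type) (h : T -> T') d w n :
  h (concat_nth d w n) = concat_nth (h d) (fun k => map h (w k)) n.
Proof.
rewrite /concat_nth; set s := flatten _.
have -> : flatten [seq map h (w k) | k <- iota 0 n.+1] = map h s.
  by rewrite map_flatten -map_comp.
have [ns|sn] := ltnP n (size s); first by rewrite (nth_map d).
by rewrite !nth_default ?size_map.
Qed.

Lemma expand_config_shift x :
  expand_config P (shiftn 1 x) =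
  shiftn (size (tilde P (x 0)))%:Z (expand_config P x).
Proof.
pose d : expand_alphabet P := inl (x 0).
apply/funext => -[n|n]; rewrite /shiftn; set s := size (tilde P (x 0)).
  rewrite -PoszD /= [RHS](concat_nth_cons _ d)// -/s ltnNge leq_addl /= addnK.
  apply: eq_concat_nth => // k _.
  by rewrite -PoszD addn1.
rewrite /= (concat_nth_cons _ d) => [|k]; last by rewrite size_rev.
have -> : Negz 0 + 1 = 0 by [].
rewrite size_rev -/s; have [sn|ns] := ltnP n s.
  have -> : Negz n + s%:Z = (s - n.+1)%N by rewrite NegzE addrC subzn.
  rewrite nth_rev// -/s [RHS](concat_nth_cons _ d)// -/s.
  by rewrite ltn_subrL (leq_ltn_trans _ sn).
have -> : Negz n + s%:Z = Negz (n - s)%N.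
  by rewrite !NegzE addrC -subSn// -subzn ?leqW// opprB.
rewrite /=; apply: eq_concat_nth => [k|k _]; first by rewrite size_rev.
by congr (rev (tilde P (x _))); rewrite !NegzE -addn1 PoszD opprD addrNK.
Qed.

Lemma expand_config_near x j :
  exists r : nat, forall y,
    (forall i : int, (absz i <= r)%N -> y i = x i) ->
    expand_config P y j = expand_config P x j.
Proof.
exists (absz j).+1 => y yx; case: j yx => n yx /=; apply: eq_concat_nth => //.
- by move=> k kn; rewrite yx//= leqW.
- by move=> k; rewrite size_rev.
- by move=> k kn; rewrite yx//= ltnS leqW.
Qed.

Lemma nbhs_config x (r : nat) :
  nbhs x [set y : config A | forall i : int, (absz i <= r)%N -> y i = x i].
Proof.
have near_i (i : int) : nbhs x [set y : config A | y i = x i].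
  exact: (@proj_continuous int (fun=> discrete_topology A) i x _
    (discrete_set1 (x i))).
elim: r => [|r IHr].
  by apply: filterS (near_i 0) => y y0 i; rewrite leqn0 absz_eq0 => /eqP->.
apply: filterS (filterI IHr (filterI (near_i r.+1%:Z) (near_i (- r.+1%:Z)))).
move=> y [yr [yP yN]] i; rewrite leq_eqVlt => /orP[|]; last exact: yr.
by case: i => n /= /eqP; [move=> ->; exact: yP|rewrite NegzE => ->; exact: yN].
Qed.

Lemma continuous_config (B : finType) (f : config A -> config B) :
  (forall x j, exists r : nat, forall y,
    (forall i : int, (absz i <= r)%N -> y i = x i) -> f y j = f x j) ->
  continuous f.
Proof.
move=> fP; apply: continuous_prod_topology => j.
apply: locally_constant_continuous => x.
have [r rP] := fP x j.
apply: (@filterS _ _ (nbhs_filter x) _ _ _ (nbhs_config x r)) => y.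
exact: rP.
Qed.

Lemma expand_config_continuous : continuous (expand_config P).
Proof. by apply: continuous_config => x j; exact: expand_config_near. Qed.

End Expand.

Lemma shift_continuous (A : finType) (n : int) : continuous (@shiftn A n).
Proof.
apply: continuous_config => x j; exists (absz (j + n)%R) => y yx.
by rewrite /shiftn yx.
Qed.

Lemma config_compact (A : finType) : compact [set: config A].
Proof.
have := @tychonoff int (fun=> discrete_topology A) (fun=> setT)
  (fun=> @finite_compact (discrete_topology A) setT (@finite_finset A setT)).
by set B := (X in compact X -> _); have -> : B = setT by rewrite eqEsubset.
Qed.

Lemma config_hausdorff (A : finType) : hausdorff_space (config A).
Proof.
by apply: (@hausdorff_product int (fun=> discrete_topology A)) => _;
  exact: discrete_hausdorff.
Qed.

Lemma image_config_closed (A B : finType) (f : config A -> config B) X :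
  continuous f -> closed X -> closed (f @` X).
Proof.
move=> fc Xc; apply: compact_closed; first exact: config_hausdorff.
apply: continuous_compact; first exact: continuous_subspaceT.
by apply: subclosed_compact Xc (@config_compact A) _.
Qed.

Lemma shift_points (X : shift_space) (n : int) (x : config (alphabet X)) :
  points X x -> points X (shiftn n x).
Proof.
have X1 y : points X y -> points X (shiftn 1 y).
  by move=> Xy; rewrite -(shift_invariant X); exists y.
have XN1 y : points X y -> points X (shiftn (-1) y).
  by rewrite -{1}(shift_invariant X) => -[z Xz <-]; rewrite shiftD addNr shift0.
elim/int_ind: n x => [|n IHn|n IHn] x Xx; first by rewrite shift0.
  by rewrite -addn1 PoszD -shiftD; apply/IHn/X1.
by rewrite -addn1 PoszD opprD -shiftD; apply/IHn/XN1.
Qed.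

Section ExpandShift.
Variables (X : shift_space) (P : pred (alphabet X)).

Definition expand_points : set (config (expand_alphabet P)) :=
  expand_config P @` X `|` shiftn 1 @` (expand_config P @` X).

Lemma expand_closed : closed expand_points.
Proof.
have Ec : closed (expand_config P @` X).
  apply: image_config_closed; last exact: shift_closed.
  exact: expand_config_continuous.
apply: closedU => //; apply: image_config_closed Ec.
exact: shift_continuous.
Qed.

Lemma expand_invariant : shiftn 1 @` expand_points = expand_points.
Proof.
rewrite eqEsubset; split=> [_ [_ [[x Xx <-]|[_ [x Xx <-] <-]] <-]|].
- by right; exists (expand_config P x) => //; exists x.
- have Xsx : points X (shiftn 1 x) by exact: shift_points.
  case Px: (P (x 0)).
    left; exists (shiftn 1 x) => //.
    by rewrite expand_config_shift shiftD /tilde insubT.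
  right; exists (expand_config P (shiftn 1 x)); first by exists (shiftn 1 x).
  by rewrite expand_config_shift /tilde insubF.
move=> _ [[x Xx <-]|[y [x Xx <-] <-]]; last first.
  by exists (expand_config P x) => //; left; exists x.
pose x' := shiftn (-1) x.
have Xx' : points X x' by exact: shift_points.
have -> : x = shiftn 1 x' by rewrite shiftD subrr shift0.
rewrite expand_config_shift /tilde; case Px: (P (x' 0)).
  exists (shiftn 1 (expand_config P x')); last by rewrite insubT shiftD.
  by right; exists (expand_config P x') => //; exists x'.
by exists (expand_config P x'); [left; exists x'|rewrite insubF].
Qed.

Definition symbol_expansion : shift_space :=
  ShiftSpace expand_closed expand_invariant.

End ExpandShift.

Arguments symbol_expansion : clear implicits.

Section ExpandMap.
Variables (Y X : shift_space) (L : alphabet Y -> alphabet X).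
Variables (f : Y -> X) (fL : one_block L f) (P : pred (alphabet X)).

Definition expand_letter (c : expand_alphabet (preim L P)) :
    expand_alphabet P :=
  match c with
  | inl a => inl (L a)
  | inr s => inr (exist (fun a => P a) (L (val s)) (valP s))
  end.

Lemma map_tilde b :
  [seq expand_letter c | c <- tilde (preim L P) b] = tilde P (L b).
Proof.
rewrite /tilde; case Pb: (P (L b)); last by rewrite !insubF.
by rewrite !insubT /=; congr [:: _; inr _]; apply: val_inj.
Qed.

Lemma expand_config_map (y : Y) (i : int) :
  expand_letter (expand_config (preim L P) (val y) i) =
  expand_config P (val (f y)) i.
Proof.
case: i => n; rewrite /= (concat_nth_map expand_letter);
  apply: eq_concat_nth => k.
- by [].
- by move=> _; rewrite map_tilde fL.
- by rewrite size_map size_rev.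
- by move=> _; rewrite map_rev map_tilde fL.
Qed.

Lemma expand_map_subproof (z : symbol_expansion Y (preim L P)) :
  (fun i => expand_letter (val z i)) \in points (symbol_expansion X P).
Proof.
apply/mem_set; case: z => z /= /set_mem [[y Yy <-]|[_ [y Yy <-] <-]].
  pose y' : Y := exist _ y (mem_set Yy).
  left; exists (val (f y')); first exact: set_mem (valP (f y')).
  by apply/funext => i; rewrite -expand_config_map.
pose y' : Y := exist _ y (mem_set Yy).
right; exists (expand_config P (val (f y'))).
  by exists (val (f y')) => //; exact: set_mem (valP (f y')).
by apply/funext => i; rewrite /shiftn -expand_config_map.
Qed.

Definition expand_map (z : symbol_expansion Y (preim L P)) :
    symbol_expansion X P :=
  exist _ (fun i => expand_letter (val z i)) (expand_map_subproof z).

End ExpandMap.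

Arguments expand_map {Y X L f} fL P z.

Definition irreducible_sofic (X : shift_space) : Prop :=
  irreducible_shift X /\ sofic X.

(* The values of [cover_shift] and [cover_map] outside the irreducible sofic
   shifts are irrelevant. *)
Record shift_cover := ShiftCover {
  cover_shift :> shift_space -> shift_space;
  cover_map : forall X, cover_shift X -> X;
  cover_irreducible : forall X, irreducible_sofic X ->
    irreducible_shift (cover_shift X);
  cover_finite_type : forall X, irreducible_sofic X ->
    shift_of_finite_type (cover_shift X);
  cover_factor_map : forall X, irreducible_sofic X ->
    factor_map (@cover_map X) }.

Arguments cover_map : clear implicits.

Definition canonical_cover (c : shift_cover) : Prop :=
  forall (X1 X2 : shift_space) (phi : X1 -> X2),
  irreducible_sofic X1 -> irreducible_sofic X2 -> conjugacy phi ->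
  exists! cphi : c X1 -> c X2,
    conjugacy cphi /\ cover_map c X2 \o cphi = phi \o cover_map c X1.

Definition respects_symbol_expansion (c : shift_cover) : Prop :=
  forall X : shift_space, irreducible_sofic X ->
  exists (L : alphabet (c X) -> alphabet X) (piL : one_block L (cover_map c X)),
  forall a : alphabet X,
  exists phi : c (symbol_expansion X (pred1 a)) ->
               symbol_expansion (c X) (preim L (pred1 a)),
    conjugacy phi /\
    expand_map piL (pred1 a) \o phi = cover_map c (symbol_expansion X (pred1 a)).

(* Main.v *)
(* Call W a tower over X if it is obtained from X by inserting, above x, a locally
   constant number r(x) - 1 of extra points between x and sigma x. A tower induces
   a flow equivalence of mapping tori, linear of slope r(x) above x, which is
   natural in one-block codes.

   After a recoding r(x) depends only on x_0, and a symbol of height at least 2 can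
   be expanded to lower the heights; hence every tower is reached by finitely many
   symbol expansions of single letters, followed by a conjugacy. For a canonical
   cover respecting symbol expansion, each of these steps yields flow equivalent
   covers, and irreducible sofic shifts remain so.

   Given a flow equivalence psi of SX1 with SX2, the image of X1 x {0} is a cross-
   section of SX2. Expanding all symbols of X2 several times makes its return times
   longer than 2; the section can then be rounded to integer times, which exhibits
   the expanded shift as a tower over X1. It is also a tower over X2. *)
Require Import Defs.
From HB Require Import structures.
From mathcomp Require Import all_boot all_order all_algebra.
From mathcomp Require Import all_classical all_reals all_analysis.
From mathcomp Require Import zify ring lra.

Set Implicit Arguments.
Unset Strict Implicit.
Unset Printing Implicit Defensive.

Import Order.TTheory GRing.Theory Num.Theory.
Import numFieldNormedType.Exports.
Local Open Scope classical_set_scope.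
Local Open Scope ring_scope.

(** * The topology of shift spaces and of mapping tori *)

(** A flow equivalence comes, point by point, with an increasing time change that is continuous
    neither in time nor in the point by definition, and that is not unique on periodic orbits. So
    nothing is read off from it directly. Compactness yields a uniform step 1/(n+1) over which every
    image path lies in one chart; the advance over such a step, being less than 1/2, is determined
    by the homeomorphism alone and varies continuously. The return time of the section is a sum of
    n+1 advances. Rounding cannot use the integer part of a time coordinate, which jumps. Instead a
    reference time in [0, 1) is attached to each of finitely many blocks, and the lift at a point is
    chosen within 1/4 of the reference of its block. Rounding times then lie in ]-1/4, 5/4[ and two
    of them differ by less than 3/2; return times above 2 therefore leave positive integers as
    heights. *)

Definition agree (A : finType) (r : nat) (x y : config A) : Prop :=
  forall i : int, (absz i <= r)%N -> y i = x i.

Definition sh (X : shift_space) (n : int) (x : X) : X :=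
  exist _ (shiftn n (val x)) (mem_set (shift_points n (set_mem (valP x)))).

Lemma pt_inj (X : shift_space) (x y : X) : val x = val y -> x = y.
Proof. exact: val_inj. Qed.

Lemma shD (X : shift_space) m n (x : X) : sh m (sh n x) = sh (m + n) x.
Proof. by apply: pt_inj; exact: shiftD. Qed.

Lemma sh0 (X : shift_space) (x : X) : sh 0 x = x.
Proof. by apply: pt_inj; exact: Defs.shift0. Qed.

Lemma shK (X : shift_space) n : cancel (@sh X n) (sh (- n)).
Proof. by move=> x; rewrite shD addNr sh0. Qed.

Lemma sh_inj (X : shift_space) n : injective (@sh X n).
Proof. exact: can_inj (@shK X n). Qed.

Lemma agreeW (A : finType) (m n : nat) (x y : config A) :
  (m <= n)%N -> agree n x y -> agree m x y.
Proof. by move=> mn xy i im; apply: xy; exact: leq_trans mn. Qed.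

Lemma agree_refl (A : finType) r (x : config A) : agree r x x.
Proof. by []. Qed.

Lemma agree_trans (A : finType) r (x y z : config A) :
  agree r x y -> agree r y z -> agree r x z.
Proof. by move=> xy yz i ir; rewrite yz// xy. Qed.

Lemma agree_shiftn (A : finType) r n (x y : config A) :
  agree (r + absz n) x y -> agree r (shiftn n x) (shiftn n y).
Proof. by move=> xy i ir; apply: xy; lia. Qed.

(** The complement of an open set around [val x] is compact and each of its points differs from
    [val x] at some coordinate, so a single window separates [x] from all of it. *)
Lemma nbhs_points (X : shift_space) (x : X) (N : set X) :
  nbhs x N <-> exists r, forall x' : X, agree r (val x) (val x') -> N x'.
Proof.
split=> [|[r rN]]; last first.
  apply: filterS rN _.
  have := @initial_continuous X (config (alphabet X)) val x _ (nbhs_config (val x) r).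
  by [].
move=> [_ [[B oB <-] Bx sB]].
suff [r rB] : exists r, forall y, agree r (val x) y -> B y.
  by exists r => x' /rB ?; exact: sB.
have cB : compact (~` B).
  by apply: subclosed_compact (@config_compact _) _ => //; exact: open_closedC.
have /compact_near_coveringP/(_ nat \oo (fun r y => ~ agree r (val x) y)) := cB.
case=> [y nBy|r _ rP]; last first.
  by exists r => y xy; apply: contrapT => nBy; exact: (rP r (leqnn r) _ nBy xy).
have [i yi] : exists i, y i <> val x i.
  apply: contrapT => h; apply: nBy; suff -> : y = val x by [].
  by apply/funext => i; apply: contrapT => yi; apply: h; exists i.
exists ([set z | agree (absz i) y z], [set n | (absz i <= n)%N]).
  by split; [exact: nbhs_config|exists (absz i)].
by move=> [z n] [/= yz ni] /(_ i ni) zi; apply: yi; rewrite -(yz i).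
Qed.

Lemma points_compact (X : shift_space) : compact [set: X].
Proof.
apply/compact_near_coveringP => J F P FF PF.
have cX : compact (points X).
  by apply: subclosed_compact (@shift_closed X) (@config_compact _) _.
have cover := (compact_near_coveringP _).1 cX J F
  (fun i z => forall x : X, val x = z -> P i x) FF.
apply: filterS (cover _) => [i Pi x _|z Xz].
  by apply: (Pi (val x)) => //; exact: set_mem (valP x).
have [[A B] [/= /nbhs_points[r rA] FB] AB] := PF (exist _ z (mem_set Xz)) I.
exists ([set y | agree r z y], B); first by split => //; exact: nbhs_config.
move=> [y i] [/= zy Bi] x xy; apply: (AB (x, i)); split => //=.
by apply: rA; move: zy; rewrite -xy.
Qed.

Lemma nbhs_points_real (R : realType) (X : shift_space) (x0 : X) (t0 : R)
    (N : set (X * R)) :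
  nbhs (x0, t0) N <-> exists r e, 0 < e /\
    forall (x : X) (t : R), agree r (val x0) (val x) -> `|t - t0| < e -> N (x, t).
Proof.
split=> [[[A B] [/= /nbhs_points[r rA] /nbhs_ballP[e /= e0 eB]] AB]|].
  exists r, e; split => // x t xx0 tt0; apply: AB; split => /=; first exact: rA.
  by apply: eB; rewrite /ball /= distrC.
move=> [r [e [e0 reN]]].
exists ([set x : X | agree r (val x0) (val x)], ball t0 e).
  split=> /=; first by apply/nbhs_points; exists r.
  exact: nbhsx_ballx.
by move=> [x t] [/= xx0 tt0]; apply: reN => //; rewrite distrC.
Qed.

Lemma torus_class_sh (R : realType) (X : shift_space) (x : X) (t : R) (n : int) :
  torus_class (sh n x) t = torus_class x (t + n%:~R).
Proof. by apply/esym/torus_classP; exists n; split => //; rewrite addrC addKr. Qed.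

Lemma torus_classE (R : realType) (X : shift_space) (x y : X) (t s : R) :
  torus_class x t = torus_class y s -> exists n : int, t = s + n%:~R /\ y = sh n x.
Proof.
move=> /torus_classP[n [tsn yx]]; exists n; split; last exact: pt_inj.
by rewrite -tsn addrC subrK.
Qed.

Lemma torusP (R : realType) (X : shift_space) (q : torus R X) :
  exists x t, q = torus_class x t.
Proof.
by exists (repr q).1, (repr q).2; rewrite /torus_class -surjective_pairing reprK.
Qed.

Lemma torus_fundP (R : realType) (X : shift_space) (q : torus R X) :
  exists x (t : R), [/\ q = torus_class x t, 0 <= t & t < 1].
Proof.
have [x [t ->]] := torusP q.
exists (sh (Num.floor t) x), (t - (Num.floor t)%:~R).
rewrite torus_class_sh subrK; split => //.
  by rewrite subr_ge0 floor_le.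
by rewrite ltrBlDl -[X in _ + X]/(1%:~R) -intrD floorD1_gt.
Qed.

(** Images of boxes are open in the quotient: two representatives differ by a shift [n] and an
    integer time, so a window larger by |n| and the remaining slack in time keep nearby classes
    inside. *)
Lemma nbhs_torus (R : realType) (X : shift_space) (x0 : X) (t0 : R)
    (N : set (torus R X)) :
  nbhs (torus_class x0 t0) N <-> exists r e, 0 < e /\
    forall (x : X) (t : R), agree r (val x0) (val x) -> `|t - t0| < e ->
    N (torus_class x t).
Proof.
split=> [Nq|[r [e [e0 reN]]]].
  have /nbhs_points_real := @pi_continuous (X * R)%type _ (x0, t0) N Nq.
  by [].
pose U : set (torus R X) :=
  [set q | exists x t, [/\ agree r (val x0) (val x), `|t - t0| < e &
                           q = torus_class x t]].
apply: (@filterS _ _ _ U) => [q [x [t [xx0 tt0 ->]]]|]; first exact: reN.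
apply: open_nbhs_nbhs; split; last first.
  by exists x0, t0; rewrite subrr normr0.
rewrite /open/= /quotient_open openE => -[x t] [x' [t' [x'r t'e]]].
move=> /esym/torus_classE[n [t'E xE]].
apply/nbhs_points_real; exists (r + absz n)%N, (e - `|t' - t0|).
split=> [|y s xy ts]; first by rewrite subr_gt0.
exists (sh (- n) y), (s + n%:~R); split.
- apply: agree_trans x'r _.
  have -> : x' = sh (- n) x by rewrite xE shK.
  by apply: agree_shiftn; rewrite abszN.
- rewrite -(subrK t' (s + _)) -addrA (le_lt_trans (ler_normD _ _))// t'E.
  by rewrite opprD addrACA subrr addr0 -t'E -ltrBrDr.
- by rewrite torus_class_sh rmorphN /= addrK.
Qed.

Lemma torus_class_continuous (R : realType) (X : shift_space) :
  continuous (fun p : X * R => torus_class p.1 p.2).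
Proof.
move=> p N; rewrite (_ : (fun p : X * R => torus_class p.1 p.2) = \pi_(torus R X)%qT).
  exact: pi_continuous.
by apply/funext => -[].
Qed.

(** The fundamental domain X x [0, 1] is compact. The index [n] is a precision; bounds valid near
    each point merge into one bound for the whole torus. *)
Lemma torus_compact_induction (R : realType) (X : shift_space)
    (P : nat -> torus R X -> Prop) :
  (forall (x : X) (t : R), exists (r : nat) (e : R) (N : nat), (0 < e) /\
    forall n (x' : X) (t' : R), (N <= n)%N ->
      agree r (val x) (val x') -> `|t' - t| < e ->
      P n (torus_class x' t')) ->
  exists N, forall n q, (N <= n)%N -> P n q.
Proof.
move=> loc.
have cXI : compact ([set: X] `*` `[0, 1]%classic : set (X * R)).
  by apply: compact_setX; [exact: points_compact|exact: segment_compact].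
have cover := (compact_near_coveringP _).1 cXI nat \oo
  (fun n p => P n (torus_class p.1 p.2)) _.
have [|N _ NP] := cover.
  move=> [x t] _; have [r [e [N [e0 NP]]]] := loc x t.
  exists ([set p : X * R | agree r (val x) (val p.1) /\ `|p.2 - t| < e],
          [set n | (N <= n)%N]); last by move=> [[x' t'] n] [/= [? ?] ?]; exact: NP.
  split=> /=; last by exists N.
  by apply/nbhs_points_real; exists r, e.
exists N => n q Nn; have [x [t [-> t0 t1]]] := torus_fundP q.
by apply: (NP n Nn (x, t)); split => //=; rewrite in_itv/= t0 ltW.
Qed.

Lemma torus_compact (R : realType) (X : shift_space) : compact [set: torus R X].
Proof.
have -> : [set: torus R X] = (fun p : X * R => torus_class p.1 p.2) @`
    ([set: X] `*` `[0, 1]%classic).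
  rewrite eqEsubset; split => // q _.
  have [x [t [-> t0 t1]]] := torus_fundP q.
  by exists (x, t) => //; split => //=; rewrite in_itv/= t0 ltW.
apply: continuous_compact.
  by apply: continuous_subspaceT; exact: torus_class_continuous.
by apply: compact_setX; [exact: points_compact|exact: segment_compact].
Qed.

Lemma near_int (R : realType) (n : int) (a : R) :
  `|a - n%:~R| < 1 / 2 -> forall m : int, `|a - m%:~R| < 1 / 2 -> m = n.
Proof.
move=> an m am.
have : `|(m - n)%:~R : R| < 1.
  rewrite intrB (_ : _ - _ = (a - n%:~R) - (a - m%:~R)); last by ring.
  by rewrite (le_lt_trans (ler_normB _ _))//; lra.
rewrite -intr_norm -[X in _ < X]/(1%:~R) ltr_int; lia.
Qed.

(** Two points that cannot be separated have arbitrarily close lifts related by an integer. At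
    precision 1/8 that integer is already the one nearest to [s - t], hence the same for every finer
    precision, and the limit relates the points themselves. *)
Lemma torus_hausdorff (R : realType) (X : shift_space) :
  hausdorff_space (torus R X).
Proof.
move=> p q; have [x [s ->]] := torusP p; have [y [t ->]] := torusP q => pq.
have meet (k : nat) (e : R) : 0 < e -> exists (x' y' : X) (s' : R) (n : int),
    [/\ agree k (val x) (val x'), agree k (val y) (val y'),
        `|s' - s| < e, `|s' - n%:~R - t| < e & y' = sh n x'].
  move=> e0.
  have [| |r []] := pq [set r | exists (x' : X) (s' : R),
      [/\ agree k (val x) (val x'), `|s' - s| < e & r = torus_class x' s']]
    [set r | exists (x' : X) (s' : R),
      [/\ agree k (val y) (val x'), `|s' - t| < e & r = torus_class x' s']].
  - by apply/nbhs_torus; exists k, e; split => // x' s' xx' ss'; exists x', s'.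
  - by apply/nbhs_torus; exists k, e; split => // x' s' xx' ss'; exists x', s'.
  move=> [x' [s' [xx' ss' ->]]] [y' [t' [yy' tt' /torus_classE[n [sn yx]]]]].
  exists x', y', s', n; split => //.
  by rewrite sn addrK.
have close (e s' : R) (n : int) : `|s' - s| < e -> `|s' - n%:~R - t| < e ->
    `|s - t - n%:~R| < 2 * e.
  by rewrite !ltr_norml => /andP[? ?] /andP[? ?]; apply/andP; lra.
have [|x1 [y1 [s1 [n [_ _ ss1 ts1 _]]]]] := meet 0%N 8^-1 _; first by lra.
have n_near : `|s - t - n%:~R| < 1 / 2 by have := close _ _ _ ss1 ts1; lra.
have meet_n (k : nat) (e : R) : 0 < e -> e <= 8^-1 ->
    (`|s - t - n%:~R| < 2 * e) /\ (exists x' y' : X,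
    [/\ agree k (val x) (val x'), agree k (val y) (val y') & y' = sh n x']).
  move=> e0 e8; have [x' [y' [s' [m [xx' yy' ss' ts' yE]]]]] := meet k e e0.
  have mn : m = n.
    by apply: near_int n_near _ _; have := close _ _ _ ss' ts'; lra.
  rewrite -mn; split; [exact: close ss' ts'|by exists x', y'].
apply/torus_classP; exists n; split.
  apply/eqP; rewrite -subr_eq0 -normr_le0 leNgt; apply/negP => d0.
  have [||] := meet_n 0%N (8^-1 * `|s - t - n%:~R|); [lra|lra|].
  by move=> + _; lra.
apply/funext => i.
have [||_ [x' [y' [xx' yy' y'E]]]] := meet_n (absz i + absz n)%N 8^-1 => //.
rewrite -yy'; last by lia.
by rewrite y'E /= /shiftn xx'//; lia.
Qed.

(** * Locally constant maps and sliding block codes *)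

Definition locally_constant (X : shift_space) (T : Type) (f : X -> T) : Prop :=
  forall x0 : X, exists r : nat, forall x : X,
    agree r (val x0) (val x) -> f x = f x0.

(** Continuity into the product topology, tested at one coordinate at a time. *)
Definition local_code (X W : shift_space) (f : X -> W) : Prop :=
  forall j : int, locally_constant (fun x => val (f x) j).

Lemma points_compact_induction (X : shift_space) (P : nat -> X -> Prop) :
  (forall x0 : X, exists r N : nat, forall n (x : X), (N <= n)%N ->
     agree r (val x0) (val x) -> P n x) ->
  exists N, forall n x, (N <= n)%N -> P n x.
Proof.
move=> loc.
have cover := (compact_near_coveringP _).1 (@points_compact X) nat \oo P _.
have [|N _ NP] := cover; last by exists N => n x Nn; exact: NP.
move=> x _; have [r [N NP]] := loc x.
exists ([set x' : X | agree r (val x) (val x')], [set n | (N <= n)%N]).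
  by split=> /=; [apply/nbhs_points; exists r|exists N].
by move=> [x' n] [/= ? ?]; exact: NP.
Qed.

Lemma locally_constant_uniform (X : shift_space) (T : Type) (f : X -> T) :
  locally_constant f -> exists r, forall x y : X,
    agree r (val x) (val y) -> f x = f y.
Proof.
move=> fl; have [|r rP] := @points_compact_induction X
    (fun r x => forall y : X, agree r (val x) (val y) -> f x = f y).
  move=> x0; have [r rP] := fl x0; exists r, r => n x rn x0x y xy.
  rewrite (rP x)// (rP y)//; apply: agree_trans x0x _; exact: agreeW xy.
by exists r => x; exact: (rP r x (leqnn r)).
Qed.

Lemma local_code_agree (X W : shift_space) (f : X -> W) (m : nat) :
  local_code f -> exists r, forall x y : X,
    agree r (val x) (val y) -> agree m (val (f x)) (val (f y)).
Proof.
move=> fl; have rP j := locally_constant_uniform (fl j).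
have [r {}rP] := choice rP.
elim: m => [|m [k IH]].
  exists (r 0) => x y xy i; rewrite leqn0 absz_eq0 => /eqP->.
  by apply/esym; exact: (rP 0).
exists (k + r (Posz m.+1) + r (- Posz m.+1))%N => x y xy i im.
have [im1|mi] := leqP (absz i) m.
  by apply: (IH x y) => //; apply: agreeW xy; lia.
have [->|->] : i = m.+1 \/ i = - m.+1%:Z by lia.
  by apply/esym; apply: (rP m.+1); apply: agreeW xy; lia.
by apply/esym; apply: (rP (- m.+1%:Z)); apply: agreeW xy; lia.
Qed.

Lemma local_code_locally_constant (X W : shift_space) (T : Type) (f : X -> W)
    (g : W -> T) :
  local_code f -> locally_constant g -> locally_constant (g \o f).
Proof.
move=> fl gl x0; have [m mP] := gl (f x0).
have [r rP] := local_code_agree m fl.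
by exists r => x x0x /=; apply: mP; exact: rP.
Qed.

Lemma local_code_comp (X W V : shift_space) (f : X -> W) (g : W -> V) :
  local_code f -> local_code g -> local_code (g \o f).
Proof.
move=> fl gl j.
exact: (@local_code_locally_constant X W _ f (fun w => val (g w) j)).
Qed.

Lemma local_code_sh (X : shift_space) (n : int) : local_code (@sh X n).
Proof. by move=> j x0; exists (absz (j + n)) => x; apply. Qed.

Lemma locally_constant2 (X : shift_space) (T1 T2 T : Type) (f : X -> T1)
    (g : X -> T2) (h : T1 -> T2 -> T) :
  locally_constant f -> locally_constant g ->
  locally_constant (fun x => h (f x) (g x)).
Proof.
move=> fl gl x0; have [r rP] := fl x0; have [s sP] := gl x0.
exists (maxn r s) => x x0x; rewrite (rP x) ?(sP x)//; apply: agreeW x0x; lia.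
Qed.

Lemma locally_constant_comp (X : shift_space) (T1 T : Type) (f : X -> T1)
    (h : T1 -> T) :
  locally_constant f -> locally_constant (fun x => h (f x)).
Proof. by move=> fl x0; have [r rP] := fl x0; exists r => x /rP ->. Qed.

Lemma equivariantP (X W : shift_space) (f : X -> W) :
  (forall x, f (sh 1 x) = sh 1 (f x)) -> forall n x, f (sh n x) = sh n (f x).
Proof.
move=> f1; have fN x : f (sh (- 1) x) = sh (- 1) (f x).
  by apply: (@sh_inj _ 1); rewrite -f1 !shD subrr !sh0.
elim/int_ind => [|n IH|n IH] x; first by rewrite !sh0.
  by rewrite -addn1 PoszD -!shD IH f1.
by rewrite -addn1 PoszD opprD -!shD IH fN.
Qed.

Lemma size_word (A : finType) (x : config A) i n : size (word x i n) = n.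
Proof. by rewrite size_map size_iota. Qed.

Lemma nth_word (A : finType) (a : A) (x : config A) i n k : (k < n)%N ->
  nth a (word x i n) k = x (i + k%:Z).
Proof. by move=> kn; rewrite (nth_map 0%N) ?size_iota// nth_iota. Qed.

Lemma eq_wordP (A : finType) (x y : config A) i j n :
  word x i n = word y j n <->
  forall k, (k < n)%N -> x (i + k%:Z) = y (j + k%:Z).
Proof.
split=> [xy k kn|xy]; first by rewrite -!(nth_word (x 0) _ _ kn) xy.
by apply/eq_in_map => k; rewrite mem_iota => /xy.
Qed.

(** The Curtis-Hedlund-Lyndon theorem: compactness gives a uniform window for the letter at 0, and
    equivariance carries the rule to the other coordinates. The value on a block is taken from any
    of its occurrences. *)
Lemma sliding_block_codeP (X W : shift_space) (f : X -> W) :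
  sliding_block_code f <->
  local_code f /\ (forall n x, f (sh n x) = sh n (f x)).
Proof.
split=> [fs|[fl fe]].
  split; last first.
    by move=> n x; apply: pt_inj; exact: sliding_block_code_shift.
  have [m [n [Phi fE]]] := fs => j x0; exists (absz j + m + n).+1 => x x0x.
  rewrite !fE; congr Phi; apply: val_inj => /=.
  by apply/eq_wordP => k kmn; apply: x0x; lia.
have [r rP] := locally_constant_uniform (fl 0).
have wP (b : blocks X (r + r).+1) : exists p : X * int,
    val b = word (val p.1) p.2 (r + r).+1.
  by have [x [i bE]] := set_mem (valP b); exists (x, i).
have [w {}wP] := choice wP.
exists r, r, (fun b => val (f (w b).1) ((w b).2 + r%:Z)) => x i.
set b := block_at _ _ _; have := wP b; case: (w b) => y j /= /eq_wordP yx.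
have := rP (sh i x) (sh (j + r%:Z) y); rewrite !fe /= /shiftn !add0r; apply.
move=> k kr /=; rewrite /shiftn.
have kE : k = (absz (k + r%:Z))%:Z - r%:Z by lia.
rewrite [in LHS]kE [in RHS]kE.
rewrite [in LHS](_ : _ + _ = j + (absz (k + r%:Z))%:Z); last by lia.
rewrite [in RHS](_ : _ + _ = i - r%:Z + (absz (k + r%:Z))%:Z); last by lia.
by rewrite yx//; lia.
Qed.

(** A continuous bijection on a compact space has a continuous inverse: near a point with
    [f x0 <> w0] one coordinate of [f x] rules out agreement with [w0] on large windows. *)
Lemma local_code_inverse (X W : shift_space) (f : X -> W) (g : W -> X) :
  local_code f -> cancel f g -> cancel g f -> local_code g.
Proof.
move=> fl fK gK j w0.
have [|r rP] := @points_compact_induction X (fun r x =>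
    agree r (val w0) (val (f x)) -> val x j = val (g w0) j).
  move=> x0; have [fx0|/eqP fx0] := eqVneq (f x0) w0.
    by exists (absz j), 0%N => n x _ x0x _; rewrite -fx0 fK x0x.
  have [i wi] : exists i, val w0 i <> val (f x0) i.
    apply: contrapT => h; apply: fx0; apply: pt_inj; apply/funext => i.
    by apply: contrapT => xi; apply: h; exists i => /esym.
  have [r rP] := fl i x0; exists r, (absz i) => n x ni /rP fx /(_ i ni) fxw.
  by exfalso; apply: wi; rewrite -fxw.
by exists r => w w0w; apply: (rP r) => //; rewrite gK.
Qed.

Lemma conjugacyP (X W : shift_space) (f : X -> W) :
  local_code f -> (forall x, f (sh 1 x) = sh 1 (f x)) ->
  (forall x y, f x = f y -> x = y) -> (forall w, exists x, f x = w) ->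
  conjugacy f.
Proof.
move=> fl /equivariantP fe finj fsurj; have [g gK] := choice fsurj.
have fK : cancel f g by move=> x; apply: finj; rewrite gK.
split; first exact/sliding_block_codeP.
exists g; split => //; apply/sliding_block_codeP; split.
  exact: local_code_inverse gK.
by move=> n w; apply: finj; rewrite fe !gK.
Qed.

(** * Towers *)

Record tower (X W : shift_space) (h : X -> W) (r : X -> nat) : Prop := Tower {
  tower_code : local_code h;
  tower_height : locally_constant r;
  tower_gt0 : forall x, (0 < r x)%N;
  tower_return : forall x, h (sh 1 x) = sh (r x)%:Z (h x);
  tower_surj : forall w, exists x (j : nat), (j < r x)%N /\ w = sh j%:Z (h x);
  tower_inj : forall x x' (j j' : nat), (j < r x)%N -> (j' < r x')%N ->
    sh j%:Z (h x) = sh j'%:Z (h x') -> x = x' /\ j = j' }.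

(** The chosen representative is normalized to a time in [0, 1), so the value does not depend on
    [repr]. *)
Definition tower_torus (R : realType) (X W : shift_space) (h : X -> W)
    (r : X -> nat) (p : torus R X) : torus R W :=
  let n := Num.floor (repr p).2 in let x := sh n (repr p).1 in
  torus_class (h x) ((r x)%:R * ((repr p).2 - n%:~R)).

(** The cocycle generated by [r]: the height climbed in [n] steps of the base, counted negatively
    for steps backwards. *)
Definition tower_sum (X : shift_space) (r : X -> nat) (x : X) (n : int) : int :=
  match n with
  | Posz n => (\sum_(k < n) r (sh k%:Z x))%N%:Z
  | Negz n => - (\sum_(k < n.+1) r (sh (- k.+1%:Z) x))%N%:Z
  end.

Lemma tower_sum0 (X : shift_space) (r : X -> nat) x : tower_sum r x 0 = 0.
Proof. by rewrite /= big_ord0. Qed.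

Lemma tower_sumS (X : shift_space) (r : X -> nat) x n :
  tower_sum r x (n + 1) = tower_sum r x n + (r (sh n x))%:Z.
Proof.
case: n => n; first by rewrite -PoszD addn1 /= big_ord_recr /= PoszD.
rewrite NegzE /= big_ord_recr /= PoszD opprD subrK.
case: n => [|n]; first by rewrite /= !big_ord0.
by have -> : - n.+2%:Z + 1 = Negz n by lia.
Qed.

Lemma floor_bounds (R : realType) (t : R) :
  (0 <= t - (Num.floor t)%:~R) /\ (t - (Num.floor t)%:~R < 1).
Proof.
rewrite subr_ge0 floor_le; split => //.
by rewrite ltrBlDl -[X in _ + X]/(1%:~R) -intrD floorD1_gt.
Qed.

Section TowerTorus.
Variables (R : realType) (X W : shift_space) (h : X -> W) (r : X -> nat).
Hypothesis hr : tower h r.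
Local Notation T := (@tower_torus R X W h r).

Lemma tower_return_sum n x : h (sh n x) = sh (tower_sum r x n) (h x).
Proof.
elim/int_rect: n => [|n IH|n IH]; first by rewrite tower_sum0 !sh0.
  rewrite -addn1 PoszD tower_sumS (_ : sh (n%:Z + 1) x = sh 1 (sh n%:Z x)).
    by rewrite (tower_return hr) IH shD addrC.
  by rewrite shD addrC.
have E := tower_sumS r x (- n.+1%:Z).
have nE : - n.+1%:Z + 1 = - n%:Z by lia.
apply: (@sh_inj _ (r (sh (- n.+1%:Z) x))%:Z).
rewrite -(tower_return hr) !shD [_ + (- _)]addrC [_ + tower_sum _ _ _]addrC.
by rewrite -E nE IH.
Qed.

Lemma tower_sum_ge x m n : m <= n -> tower_sum r x m + (n - m) <= tower_sum r x n.
Proof.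
move=> mn; have {mn} [k ->] : exists k : nat, n = m + k%:Z.
  by exists (absz (n - m)); lia.
elim: k => [|k]; first by rewrite !addr0 subrr addr0.
have := tower_sumS r x (m + k%:Z); have := tower_gt0 hr (sh (m + k%:Z) x).
have -> : m + k%:Z + 1 = m + k.+1%:Z by lia.
lia.
Qed.

Lemma tower_sum_floor x (b : int) :
  exists n, (tower_sum r x n <= b) && (b < tower_sum r x (n + 1)).
Proof.
elim/int_ind: b => [|b [n /andP[nb bn]]|b [n /andP[nb bn]]].
- exists 0; rewrite tower_sumS tower_sum0; have := tower_gt0 hr (sh 0 x); lia.
- have [ltn|] := ltP (b.+1%:Z) (tower_sum r x (n + 1)).
    by exists n; lia.
  move=> le; exists (n + 1); rewrite (tower_sumS r x (n + 1)).
  have := tower_gt0 hr (sh (n + 1) x); lia.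
- have [le|lt] := leP (tower_sum r x n) (- b.+1%:Z); first by exists n; lia.
  exists (n - 1); rewrite subrK; have := tower_sumS r x (n - 1); rewrite subrK.
  have := tower_gt0 hr (sh (n - 1) x); lia.
Qed.

Lemma tower_torusE x (t : R) : 0 <= t -> t < 1 ->
  T (torus_class x t) = torus_class (h x) ((r x)%:R * t).
Proof.
move=> t0 t1; rewrite /tower_torus; set p := repr _.
have [n [tE xE]] : exists n : int, p.2 = t + n%:~R /\ x = sh n p.1.
  apply: torus_classE.
  by rewrite {1}/torus_class -surjective_pairing reprK.
have -> : Num.floor p.2 = n.
  by apply: floor_def; rewrite tE intrD; lra.
by rewrite -xE tE addrK.
Qed.

(** The lift of [T] to the flow line of [x]: piecewise linear, with slope the height and with
    [tower_sum] as its values at the integers. Being an increasing bijection of the line, it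
    provides the time change and its inverse. *)
Definition tower_time x (t : R) : R :=
  let n := Num.floor t in
  (tower_sum r x n)%:~R + (r (sh n x))%:R * (t - n%:~R).

Lemma tower_timeE x t : T (torus_class x t) = torus_class (h x) (tower_time x t).
Proof.
have [t0 t1] := floor_bounds t.
rewrite /tower_time -[t in LHS](subrK (Num.floor t)%:~R) -torus_class_sh.
by rewrite tower_torusE// tower_return_sum torus_class_sh addrC.
Qed.

Lemma tower_time_homo x : {homo tower_time x : s t / s < t}.
Proof.
move=> s t st; have [s0 s1] := floor_bounds s; have [t0 t1] := floor_bounds t.
have rs : (0 < (r (sh (Num.floor s) x))%:R :> R) by rewrite ltr0n (tower_gt0 hr).
have rt : (0 < (r (sh (Num.floor t) x))%:R :> R) by rewrite ltr0n (tower_gt0 hr).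
rewrite /tower_time; have := le_floor (ltW st); rewrite le_eqVlt => /orP[/eqP E|lt].
  by rewrite E ltrD2l ltr_pM2l -?E// ltrD2r.
have : tower_sum r x (Num.floor s) + (r (sh (Num.floor s) x))%:Z <=
    tower_sum r x (Num.floor t).
  rewrite -tower_sumS; have := @tower_sum_ge x (Num.floor s + 1) (Num.floor t) _.
  have lt2 : Num.floor s + 1 <= Num.floor t by rewrite lezD1.
  by move=> /(_ lt2); apply: le_trans; rewrite lerDl subr_ge0.
rewrite -(ler_int R) intrD -[X in _ + X]/((r _)%:R) => le.
have a : (r (sh (Num.floor s) x))%:R * (s - (Num.floor s)%:~R) <
   (r (sh (Num.floor s) x))%:R by rewrite gtr_pMr.
have b : 0 <= (r (sh (Num.floor t) x))%:R * (t - (Num.floor t)%:~R).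
  by rewrite mulr_ge0// ltW.
lra.
Qed.

Lemma tower_time_surj x b : exists t, tower_time x t = b.
Proof.
have [n /andP[nb bn]] := tower_sum_floor x (Num.floor b).
have [b0 b1] := floor_bounds b.
have r0 : (0 < (r (sh n x))%:R :> R) by rewrite ltr0n (tower_gt0 hr).
pose u := (b - (tower_sum r x n)%:~R) / (r (sh n x))%:R.
have nbR : (tower_sum r x n)%:~R <= (Num.floor b)%:~R :> R by rewrite ler_int.
have bnR : (Num.floor b)%:~R + 1 <= (tower_sum r x n)%:~R + (r (sh n x))%:R :> R.
  rewrite -[X in X <= _](intrD R _ 1) -[X in _ <= _ + X]/((r _)%:Z%:~R) -intrD ler_int.
  by rewrite -tower_sumS lezD1.
have u0 : 0 <= u by apply: divr_ge0; [lra|exact: ltW].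
have u1 : u < 1 by rewrite ltr_pdivrMr// mul1r; lra.
exists (n%:~R + u); rewrite /tower_time.
have -> : Num.floor (n%:~R + u) = n by apply: floor_def; rewrite intrD; lra.
rewrite [n%:~R + u]addrC addrK /u mulrC divfK ?gt_eqF//; lra.
Qed.

Lemma tower_torus_continuous : continuous T.
Proof.
(* Near an integer time, the two linear pieces are compared after rewriting
   [x, s] with s < 0 as [sigma^-1 x, s + 1]. *)
move=> p; have [x [t [-> t0 t1]]] := torus_fundP p => N.
rewrite tower_torusE// => /nbhs_torus [k [e [e0 kN]]].
have [m1 mP1] := local_code_agree k (tower_code hr).
have [m2 mP2] := tower_height hr x.
have [m3 mP3] := tower_height hr (sh (- 1) x).
have r0 : (0 < (r x)%:R :> R) by rewrite ltr0n (tower_gt0 hr).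
have r0' : (0 < (r (sh (-1) x))%:R :> R) by rewrite ltr0n (tower_gt0 hr).
have mP3' (x' : X) : agree (m1 + m2 + m3 + 1) (val x) (val x') ->
    r (sh (- 1) x') = r (sh (-1) x).
  by move=> xx'; apply: mP3; apply: agree_shiftn; apply: agreeW xx'; lia.
(* One radius serves both slopes, the one above [x] and the one above its predecessor. *)
pose e1 := e / ((r x)%:R + (r (sh (-1) x))%:R).
have e10 : 0 < e1 by rewrite divr_gt0// addr_gt0.
have e1E : ((r x)%:R + (r (sh (-1) x))%:R) * e1 = e.
  by rewrite mulrC divfK// gt_eqF// addr_gt0.
have [t00|t00] := eqVneq t 0.
  apply/nbhs_torus; exists (m1 + m2 + m3 + 1)%N, (Num.min 1 e1).
  split=> [|x' s xx']; first by rewrite lt_min ltr01.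
  move: kN; rewrite {}t00 {t t0 t1} mulr0 lt_min subr0 => kN /andP[s1 se].
  have rx : r x' = r x by apply: mP2; apply: agreeW xx'; lia.
  have hx : agree k (val (h x)) (val (h x')).
    by apply: mP1; apply: agreeW xx'; lia.
  have [s0|s0] := leP 0 s.
    move: s1 se; rewrite !ger0_norm// => s1 se; rewrite /= tower_torusE//.
    apply: kN => //; rewrite rx subr0 ger0_norm ?mulr_ge0//; nra.
  move: s1 se; rewrite !ltr0_norm// => s1 se.
  have -> : torus_class x' s = torus_class (sh (-1) x') (s + 1).
    by rewrite torus_class_sh rmorphN /= addrK.
  rewrite /= tower_torusE//; try lra.
  rewrite mulrDr mulr1 -[X in _ + X]/((r _)%:Z%:~R) -torus_class_sh.
  rewrite -(tower_return hr) shD subrr sh0 mP3'//; apply: kN => //.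
  by rewrite subr0 ltr_norml; apply/andP; split; nra.
have {t00 t0} t0 : 0 < t by rewrite lt_neqAle eq_sym t00.
apply/nbhs_torus; exists (m1 + m2)%N, (Num.min e1 (Num.min t (1 - t))).
split=> [|x' s xx']; first by rewrite !lt_min; apply/and3P; split => //; lra.
have hx := mP1 _ _ (agreeW (leq_addr _ _) xx').
have rx := mP2 _ (agreeW (leq_addl _ _) xx').
rewrite !lt_min => /and3P[]; rewrite !ltr_norml.
move=> /andP[? ?] /andP[? ?] /andP[? ?].
rewrite /= tower_torusE; try lra.
apply: kN => //; rewrite rx -mulrBr ltr_norml; apply/andP; split; nra.
Qed.
End TowerTorus.
Arguments tower_return_sum {X W h r} hr n x.
Arguments tower_torusE {R X W} h r [x t].
Arguments tower_timeE {R X W h r} hr x t.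
Arguments tower_time_homo {R X W h r} hr x.
Arguments tower_time_surj {R X W h r} hr x.

(** * Orbit equivalences of tori and of codes *)

Lemma compact_bijection_homeomorphism (S T : topologicalType) (f : S -> T) :
  compact [set: S] -> hausdorff_space T -> continuous f -> injective f ->
  (forall y, exists x, f x = y) -> homeomorphism f.
Proof.
move=> cS hT cf finj fsurj; split => //; have [g gK] := choice fsurj.
have fK : cancel f g by move=> x; apply: finj; rewrite gK.
exists g; split => //; apply/continuous_closedP => C cC.
have -> : g @^-1` C = f @` C.
  rewrite eqEsubset; split=> [y Cgy|_ [x Cx <-]] /=; last by rewrite fK.
  by exists (g y).
apply: compact_closed => //; apply: continuous_compact.
  exact: continuous_subspaceT.
exact: subclosed_compact cC cS _.
Qed.

(* Unlike [flow_equivalence], this is visibly closed under inverses: the time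
   change has an inverse. *)
Definition orbit_equivalence (R : realType) (X Y : shift_space)
    (psi : torus R X -> torus R Y) : Prop :=
  homeomorphism psi /\
  forall p, exists f g : R -> R, [/\ {homo f : s t / s < t}, cancel f g,
    cancel g f & forall t, psi (flow t p) = flow (f t) (psi p)].

Definition orbit_equivalent_codes (R : realType) (Y X Y' X' : shift_space)
    (f : Y -> X) (f' : Y' -> X') : Prop :=
  exists (psi : torus R Y -> torus R Y') (phi : torus R X -> torus R X'),
    [/\ orbit_equivalence psi, orbit_equivalence phi &
        phi \o torus_map f = torus_map f' \o psi].

Section OrbitEquivalence.
Variable R : realType.

Lemma orbit_equivalence_flow (X Y : shift_space) (psi : torus R X -> torus R Y) :
  orbit_equivalence psi -> flow_equivalence psi.
Proof.
move=> [hpsi psif]; split=> // p; have [f [g [fh _ _ fE]]] := psif p.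
by exists f.
Qed.

Lemma orbit_equivalence_comp (X Y Z : shift_space)
    (psi : torus R X -> torus R Y) (phi : torus R Y -> torus R Z) :
  orbit_equivalence psi -> orbit_equivalence phi -> orbit_equivalence (phi \o psi).
Proof.
move=> [[psic [psi' [psi'c psiK psi'K]]] psif] [[phic [phi' [phi'c phiK phi'K]]] phif].
split.
  split; first by move=> p; apply: continuous_comp; [exact: psic|exact: phic].
  exists (psi' \o phi'); split.
  - by move=> p; apply: continuous_comp; [exact: phi'c|exact: psi'c].
  - by move=> p /=; rewrite phiK psiK.
  - by move=> p /=; rewrite psi'K phi'K.
move=> p; have [f [f' [fh fK f'K fE]]] := psif p.
have [g [g' [gh gK g'K gE]]] := phif (psi p).
exists (g \o f), (f' \o g'); split.
- by move=> s t st /=; apply/gh/fh.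
- by move=> t /=; rewrite gK fK.
- by move=> t /=; rewrite f'K g'K.
- by move=> t /=; rewrite fE gE.
Qed.

Lemma orbit_equivalence_inv (X Y : shift_space) (psi : torus R X -> torus R Y) :
  orbit_equivalence psi -> exists phi : torus R Y -> torus R X,
  [/\ orbit_equivalence phi, cancel psi phi & cancel phi psi].
Proof.
move=> [[psic [phi [phic psiK phiK]]] psif]; exists phi; split => //.
split; first by split=> //; exists psi.
move=> q; have [f [g [fh fK gK fE]]] := psif (phi q).
exists g, f; split => // [s t st|t]; last first.
  by rewrite -[LHS](psiK) // -[t in LHS]gK -{1}[q]phiK -fE !psiK.
rewrite ltNge; apply/negP; rewrite le_eqVlt => /orP[/eqP E|/fh].
  by move: st; rewrite -(gK s) -(gK t) E ltxx.
by rewrite !gK => /(lt_trans st); rewrite ltxx.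
Qed.

Lemma orbit_equivalent_codes_flow (Y X Y' X' : shift_space)
    (f : Y -> X) (f' : Y' -> X') :
  orbit_equivalent_codes R f f' -> flow_equivalent_codes R f f'.
Proof.
move=> [psi [phi [psiO phiO E]]]; exists psi, phi.
by split => //; exact: orbit_equivalence_flow.
Qed.

Lemma orbit_equivalent_codes_sym (Y X Y' X' : shift_space)
    (f : Y -> X) (f' : Y' -> X') :
  orbit_equivalent_codes R f f' -> orbit_equivalent_codes R f' f.
Proof.
move=> [psi [phi [psiO phiO E]]].
have [psi' [psi'O psiK psi'K]] := orbit_equivalence_inv psiO.
have [phi' [phi'O phiK phi'K]] := orbit_equivalence_inv phiO.
exists psi', phi'; split=> //; apply/funext => q /=.
apply: (can_inj phiK); rewrite phi'K.
by have /(congr1 (@^~ (psi' q))) /= -> := E; rewrite psi'K.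
Qed.

Lemma orbit_equivalent_codes_trans (Y X Y' X' Y'' X'' : shift_space)
    (f : Y -> X) (f' : Y' -> X') (f'' : Y'' -> X'') :
  orbit_equivalent_codes R f f' -> orbit_equivalent_codes R f' f'' ->
  orbit_equivalent_codes R f f''.
Proof.
move=> [psi [phi [psiO phiO E]]] [psi' [phi' [psi'O phi'O E']]].
exists (psi' \o psi), (phi' \o phi); split.
- exact: orbit_equivalence_comp.
- exact: orbit_equivalence_comp.
- by rewrite -compA E compA E' -compA.
Qed.

Lemma tower_torus_inj (X W : shift_space) (h : X -> W) (r : X -> nat) :
  tower h r -> injective (@tower_torus R X W h r).
Proof.
move=> hr p q; have [x [s [-> s0 s1]]] := torus_fundP p.
have [y [t [-> t0 t1]]] := torus_fundP q.
rewrite !tower_torusE//.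
(* The height above the base splits into a floor number and a remainder in [0, 1). Equal classes
   have equal remainders, so [tower_inj] applies to the floors. *)
have split_height (z : X) (u : R) : 0 <= u -> u < 1 -> exists (j : nat) (v : R),
    [/\ (j < r z)%N, 0 <= v, v < 1 & (r z)%:R * u = v + j%:R].
  move=> u0 u1; have rz : (0 < (r z)%:R :> R) by rewrite ltr0n (tower_gt0 hr).
  have ru0 : 0 <= (r z)%:R * u by rewrite mulr_ge0// ltW.
  have [v0 v1] := floor_bounds ((r z)%:R * u).
  have [j jE] : exists j : nat, Num.floor ((r z)%:R * u) = j%:Z.
    exists (absz (Num.floor ((r z)%:R * u))); rewrite gez0_abs//.
    by rewrite floor_ge0.
  move: v0 v1; rewrite jE => v0 v1.
  exists j, ((r z)%:R * u - j%:~R); split => //; last by rewrite subrK.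
  rewrite -(ltr_nat R) -[j%:R]/(j%:~R); nra.
have [j [v [jr v0 v1 sE]]] := split_height x s s0 s1.
have [j' [v' [jr' v0' v1' tE]]] := split_height y t t0 t1.
rewrite sE tE -[j%:R]/(j%:~R) -[j'%:R]/(j'%:~R) -!torus_class_sh.
move=> /torus_classE[n [vE hE]].
have n0 : n = 0.
  apply/eqP; rewrite -(@intr_eq0 R); apply/eqP.
  have : `|n%:~R : R| < 1 by rewrite ltr_norml; apply/andP; split; lra.
  by rewrite -intr_norm -[X in _ < X]/(1%:~R) ltr_int => n1; have -> : n = 0 by lia.
move: vE hE; rewrite n0 addr0 sh0 => vE /(tower_inj hr) -/(_ jr' jr)[yx jj'].
have rx : (0 < (r x)%:R :> R) by rewrite ltr0n (tower_gt0 hr).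
rewrite yx; congr torus_class; apply: (@mulfI _ (r x)%:R); first by rewrite gt_eqF.
by rewrite sE vE -jj' -tE yx.
Qed.

Lemma tower_torus_surj (X W : shift_space) (h : X -> W) (r : X -> nat) :
  tower h r -> forall q, exists p, @tower_torus R X W h r p = q.
Proof.
move=> hr q; have [w [s ->]] := torusP q.
have [x [j [_ ->]]] := tower_surj hr w; rewrite torus_class_sh.
have [t tE] := tower_time_surj hr x (s + j%:~R).
by exists (torus_class x t); rewrite (tower_timeE hr) tE.
Qed.

Lemma tower_torus_orbit_equivalence (X W : shift_space) (h : X -> W)
    (r : X -> nat) : tower h r -> orbit_equivalence (@tower_torus R X W h r).
Proof.
move=> hr; split.
  apply: compact_bijection_homeomorphism.
  - exact: torus_compact.
  - exact: torus_hausdorff.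
  - exact: tower_torus_continuous.
  - exact: tower_torus_inj.
  - exact: tower_torus_surj.
move=> p; have [x [s ->]] := torusP p.
pose f t := tower_time r x (s + t) - tower_time r x s.
have fh : {homo f : t u / t < u}.
  by move=> t u tu; rewrite ltrD2r (tower_time_homo hr)// ltrD2l.
have fsurj b : exists t, f t = b.
  have [t tE] := tower_time_surj hr x (b + tower_time r x s).
  by exists (t - s); rewrite /f [s + _]addrC subrK tE addrK.
have [g gK] := choice fsurj.
exists f, g; split => // t; last first.
  by rewrite flowE !(tower_timeE hr) flowE /f [tower_time r x s + _]addrC subrK.
have [| |//] := ltgtP (g (f t)) t => /fh; by rewrite gK ltxx.
Qed.

(** The height above [y] is that above [f y], so both torus maps use the same slope and the square
    of tori commutes as soon as the square of bases does. *)
Lemma tower_orbit_equivalent_codes (Y X V W : shift_space) (f : Y -> X)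
    (g : V -> W) (h' : Y -> V) (h : X -> W) (r : X -> nat) :
  sliding_block_code f -> sliding_block_code g ->
  tower h' (r \o f) -> tower h r -> g \o h' = h \o f ->
  orbit_equivalent_codes R f g.
Proof.
move=> fs gs hr' hr E; exists (tower_torus h' (r \o f)), (tower_torus h r).
split; [exact: tower_torus_orbit_equivalence..|].
apply/funext => p /=; have [y [t [-> t0 t1]]] := torus_fundP p.
rewrite (torus_mapE fs) tower_torusE// tower_torusE//.
by rewrite (torus_mapE gs); have /(congr1 (@^~ y)) /= -> := E.
Qed.
End OrbitEquivalence.

(** * Conjugacies, irreducibility, soficity and finite type *)

Lemma conjugacy_tower (X W : shift_space) (f : X -> W) :
  conjugacy f -> tower f (fun=> 1%N).
Proof.
move=> [/sliding_block_codeP[fl fe] [g [_ fK gK]]]; split => //.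
- by move=> x0; exists 0%N.
- by move=> w; exists (g w), 0%N; split=> //; rewrite gK sh0.
- by move=> x x' [|//] [|//] _ _; rewrite !sh0 => /(can_inj fK).
Qed.

Lemma conjugacy_inv (X W : shift_space) (f : X -> W) : conjugacy f ->
  exists g, [/\ conjugacy g, cancel f g & cancel g f].
Proof.
by move=> [fs [g [gs fK gK]]]; exists g; split => //; split => //; exists f.
Qed.

Lemma wordD (A : finType) (x : config A) i m n :
  word x i (m + n) = word x i m ++ word x (i + m%:Z) n.
Proof.
rewrite /word iotaD map_cat add0n; congr cat.
rewrite -[X in iota X _](addn0 m) iotaDl -map_comp; apply: eq_map => k /=.
by rewrite PoszD addrA.
Qed.

(** Topological transitivity with arbitrarily late visits. In this form irreducibility passes to
    towers, where [N] absorbs the offset between floors. *)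
Lemma irreducible_shiftP (X : shift_space) : irreducible_shift X <->
  forall (x x' : X) (r N : nat), exists (z : X) (k : nat), [/\ (N <= k)%N,
    agree r (val x) (val z) & agree r (val x') (val (sh k%:Z z))].
Proof.
split=> [irr x x' r N|irr u v [x [i uE]] [x' [i' vE]]]; last first.
  have [z [k [nk xz xz']]] := irr (sh i x) (sh i' x') (size u + size v)%N (size u).
  exists (word (val z) (size u)%:Z (k - size u)), z, 0.
  have -> : u = word (val z) 0 (size u).
    rewrite uE !size_word; apply/eq_wordP => j jn.
    by rewrite xz /= /shiftn; [congr (val x _); lia|lia].
  have -> : v = word (val z) k%:Z (size v).
    rewrite vE !size_word; apply/eq_wordP => j jn.
    have := xz' j%:Z; rewrite /= /shiftn [_ + k%:Z]addrC => ->; last by lia.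
    by congr (val x' _); lia.
  rewrite !size_cat !size_word [RHS]wordD; congr cat; rewrite add0r.
  by rewrite [RHS]wordD -PoszD subnKC.
have lang (y : X) i n : language X (word (val y) i n).
  by exists y, i; rewrite size_word.
(* The word around [x] is prolonged by [N] letters, which keeps the two occurrences at least [N]
   apart. *)
have [w [z0 [i0 E]]] := irr _ _ (lang x (- r%:Z) (r + r + 1 + N)%N)
  (lang x' (- r%:Z) (r + r + 1)%N).
move: E; rewrite !size_cat !size_word; set u := word _ _ _; set v := word _ _ _.
move=> E; exists (sh (i0 + r%:Z) z0), (r + r + 1 + N + size w)%N.
have nthE j : (j < r + r + 1 + N + (size w + (r + r + 1)))%N ->
    nth (val x 0) (u ++ w ++ v) j = val z0 (i0 + j%:Z).
  by move=> jn; rewrite E nth_word.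
split; first by lia.
  move=> i ir; have := nthE (absz (i + r%:Z)%R).
  rewrite nth_cat size_word ifT; last by lia.
  rewrite nth_word; last by lia.
  rewrite /= /shiftn (_ : (- r%:Z + (absz (i + r%:Z)%R)%:Z)%R = i); last by lia.
  by move=> ->; [congr (val z0 _); lia|lia].
move=> i ir; have := nthE (r + r + 1 + N + (size w + absz (i + r%:Z)%R))%N.
rewrite nth_cat size_word ifF; last by lia.
rewrite addKn nth_cat ifF; last by rewrite ltnNge leq_addr.
rewrite addKn.
rewrite nth_word; last by lia.
rewrite (_ : (- r%:Z + (absz (i + r%:Z)%R)%:Z)%R = i); last by lia.
by rewrite /= /shiftn => ->; [congr (val z0 _); lia|lia].
Qed.

Lemma tower_irreducible (X W : shift_space) (h : X -> W) (r : X -> nat) :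
  tower h r -> irreducible_shift X -> irreducible_shift W.
Proof.
move=> hr /irreducible_shiftP irr; apply/irreducible_shiftP => w w' m N.
have [x [j [jr ->]]] := tower_surj hr w.
have [x' [j' [jr' ->]]] := tower_surj hr w'.
have [R RP] := local_code_agree (m + j + j') (tower_code hr).
(* Each step of the base climbs at least one floor, so [k >= N + j] still leaves time [N] after the
   first [j] floors are subtracted. *)
have [z [k [Nk /RP xz /RP xz']]] := irr x x' R (N + j)%N.
have := tower_sum_ge hr z (le0z_nat k); rewrite tower_sum0 add0r subr0 => kS.
exists (sh j%:Z (h z)), (absz (j'%:Z + tower_sum r z k%:Z - j%:Z)%R).
split; first by lia.
  by apply: agree_shiftn; apply: agreeW xz; lia.
rewrite shD (_ : _ + _ = j'%:Z + tower_sum r z k%:Z); last by lia.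
rewrite -shD -(tower_return_sum hr).
by apply: agree_shiftn; apply: agreeW xz'; lia.
Qed.

Lemma factor_map_comp (X Y Z : shift_space) (f : X -> Y) (g : Y -> Z) :
  factor_map f -> factor_map g -> factor_map (g \o f).
Proof.
move=> [/sliding_block_codeP[fl fe] fs] [/sliding_block_codeP[gl ge] gs].
split; last by move=> z; have [y <-] := gs z; have [x <-] := fs y; exists x.
apply/sliding_block_codeP; split; first exact: local_code_comp.
by move=> n x /=; rewrite fe ge.
Qed.

Lemma conjugacy_factor_map (X W : shift_space) (f : X -> W) :
  conjugacy f -> factor_map f.
Proof. by move=> [fs [g [_ _ gK]]]; split => // w; exists (g w). Qed.

Lemma conjugacy_irreducible_sofic (X W : shift_space) (f : X -> W) :
  conjugacy f -> irreducible_sofic X -> irreducible_sofic W.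
Proof.
move=> fc [irr [Y [g [sft gf]]]]; split.
  exact: tower_irreducible (conjugacy_tower fc) irr.
exists Y, (f \o g); split => //; apply: factor_map_comp gf _.
exact: conjugacy_factor_map.
Qed.

(** A finite list of forbidden words has a maximal length, which serves as window. Conversely the
    words of length [n] outside the language form a finite list. *)
Lemma shift_of_finite_typeP (X : shift_space) : shift_of_finite_type X <->
  exists n : nat, forall z : config (alphabet X),
    (forall i : int, exists x : X, forall k : nat, (k < n)%N ->
       val x k%:Z = z (i + k%:Z)) -> points X z.
Proof.
split=> [[F XE]|[n nP]].
  exists (\max_(w <- F) size w) => z zP; rewrite XE => i w wF zw.
  have [x xz] := zP i; have := set_mem (valP x); rewrite {1}XE => /(_ 0 w wF).
  apply; rewrite -[RHS]zw; apply/eq_wordP => k kw; rewrite add0r; apply: xz.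
  exact: leq_trans kw (leq_bigmax_seq _ wF _).
exists [seq w <- [seq val w | w <- enum {: n.-tuple (alphabet X)}] |
        `[< ~ language X w >]].
rewrite eqEsubset; split=> [x Xx i w|z zP].
  rewrite mem_filter => /andP[/asboolP wX _] xw; apply: wX; rewrite -xw.
  by exists (exist _ x (mem_set Xx)), i; rewrite size_word.
apply: nP => i; have szn : size (word z i n) == n by rewrite size_word.
have : language X (word z i n).
  apply: contrapT => nl; apply: (zP i (word z i n)); last by rewrite size_word.
  rewrite mem_filter; apply/andP; split; first exact/asboolP.
  by apply/mapP; exists (Tuple szn) => //; rewrite mem_enum.
move=> [x [j]]; rewrite size_word => /eq_wordP E; exists (sh j x) => k kn.
by rewrite E//= /shiftn addrC.
Qed.

(** * Symbol expansions *)

Section ExpandConfig.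
Variables (A : finType) (P : pred A).
Implicit Types x y : config A.
Local Notation len a := (size (tilde P a)).

Lemma size_tilde (a : A) : len a = if P a then 2%N else 1%N.
Proof. by rewrite /tilde; case: ifP => Pa; [rewrite insubT|rewrite insubF]. Qed.

Lemma size_tilde_gt0 (a : A) : (0 < len a)%N.
Proof. by []. Qed.

Lemma size_tilde_le2 (a : A) : (len a <= 2)%N.
Proof. by rewrite size_tilde; case: ifP. Qed.

Lemma expand_config0 x : expand_config P x 0 = inl (x 0).
Proof. by []. Qed.

Lemma expand_config1 x (Px : P (x 0)) :
  expand_config P x 1 = inr (exist _ (x 0) Px).
Proof. by rewrite /= /concat_nth /= insubT. Qed.

Lemma expand_configN1 x : expand_config P x (-1) =
  last (inl (x 0)) (tilde P (x (-1))).
Proof.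
rewrite /= /concat_nth /= /tilde.
by case: insub.
Qed.

Lemma expand_config_shiftS x j : expand_config P (shiftn 1 x) j =
  expand_config P x (j + (len (x 0))%:Z).
Proof. by rewrite expand_config_shift. Qed.

Lemma expand_config_shiftN x j : expand_config P x j =
  expand_config P (shiftn (-1) x) (j + (len (x (-1)))%:Z).
Proof.
have := expand_config_shiftS (shiftn (-1) x) j.
rewrite shiftD subrr Defs.shift0 => ->.
by have -> : shiftn (-1) x 0 = x (-1) by rewrite /shiftn add0r.
Qed.

Lemma expand_config_shiftn x n : exists m, forall j,
  expand_config P (shiftn n x) j = expand_config P x (j + m).
Proof.
elim/int_rect: n => [|n [m mP]|n [m mP]].
- by exists 0 => j; rewrite addr0 Defs.shift0.
- exists (m + (len (shiftn n%:Z x 0))%:Z) => j.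
  rewrite -[n.+1]addn1 PoszD addrC -shiftD expand_config_shiftS mP.
  by rewrite -addrA [m + _]addrC.
- exists (m - (len (shiftn (- n%:Z) x (-1)))%:Z) => j.
  have := expand_config_shiftN (shiftn (- n%:Z) x)
     (j - (len (shiftn (- n%:Z) x (-1)))%:Z).
  rewrite subrK shiftD (_ : -1 + - n%:Z = - n.+1%:Z); last by lia.
  by move=> <-; rewrite mP; congr expand_config; lia.
Qed.

(** The letter at 0 shows [x 0], and the letter at -1 shows how long the expansion of [x (-1)] is.
    Equality of expansions thus survives moving [x] by one letter either way. *)
Lemma expand_config_inj : injective (@expand_config A P).
Proof.
have stepS x y : expand_config P x = expand_config P y ->
    expand_config P (shiftn 1 x) = expand_config P (shiftn 1 y).
  move=> E; apply/funext => j; rewrite !expand_config_shiftS E.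
  by have [->] : inl (x 0) = inl (y 0) :> expand_alphabet P;
    first by rewrite -!expand_config0 E.
have stepN x y : expand_config P x = expand_config P y ->
    expand_config P (shiftn (-1) x) = expand_config P (shiftn (-1) y).
  move=> E; apply/funext => j.
  have lenE : len (x (-1)) = len (y (-1)).
    have := congr1 (fun z => z (-1)) E; rewrite !expand_configN1 /tilde.
    by case: insubP => [? _ _|_]; case: insubP.
  have := expand_config_shiftN x (j - (len (x (-1)))%:Z); rewrite subrK => <-.
  by have := expand_config_shiftN y (j - (len (x (-1)))%:Z); rewrite -lenE subrK => <-; rewrite E.
have step n x y : expand_config P x = expand_config P y ->
    expand_config P (shiftn n x) = expand_config P (shiftn n y).
  elim/int_rect: n => [|n IH|n IH] E; first by rewrite !Defs.shift0.
    by rewrite -addn1 PoszD addrC -!shiftD; apply/stepS/IH.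
  have -> : - n.+1%:Z = -1 + - n%:Z by lia.
  by rewrite -!shiftD; apply/stepN/IH.
move=> x y E; apply/funext => n; have := congr1 (fun z => z 0) (step n x y E).
by rewrite !expand_config0 /shiftn !add0r => -[].
Qed.

Lemma expand_config_window n x y :
  (forall k : nat, (k < n.*2)%N ->
     expand_config P x k%:Z = expand_config P y k%:Z) ->
  forall k : nat, (k < n)%N -> x k%:Z = y k%:Z.
Proof.
elim: n x y => // n IH x y E; have [xy] := E 0%N isT.
case=> [|k] kn //; have := IH (shiftn 1 x) (shiftn 1 y) _ k kn.
rewrite /shiftn -PoszD addn1; apply => i i_n.
by rewrite !expand_config_shiftS -xy -PoszD; apply: E; have := size_tilde_le2 (x 0); lia.
Qed.

(* The two-letter blocks allowed in an expansion. *)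
Definition expand_step (c d : expand_alphabet P) : bool :=
  match c, d with
  | inl a, inl _ => ~~ P a
  | inl a, inr s => val s == a
  | inr _, inl _ => true
  | inr _, inr _ => false
  end.

Lemma expand_config_step01 x : expand_step (expand_config P x 0) (expand_config P x 1).
Proof.
rewrite expand_config0; case Px: (P (x 0)).
  by rewrite (expand_config1 Px) /= eqxx.
have := expand_config_shiftS x 0; rewrite size_tilde Px add0r => <-.
by rewrite expand_config0 /= Px.
Qed.

Lemma expand_config_step12 x : P (x 0) ->
  expand_step (expand_config P x 1) (expand_config P x 2).
Proof.
move=> Px; rewrite (expand_config1 Px).
by have := expand_config_shiftS x 0; rewrite size_tilde Px add0r => <-.
Qed.

Definition is_old (c : expand_alphabet P) : bool := if c is inl _ then true else false.

Definition old_letter (c : expand_alphabet P) : A :=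
  match c with inl a => a | inr s => val s end.

Definition well_expanded (z : config (expand_alphabet P)) : Prop :=
  (forall i, expand_step (z i) (z (i + 1))) /\ is_old (z 0).

(** No two new symbols are adjacent under [expand_step], so the next old letter is one or two places
    away. *)
Definition next_old (z : config (expand_alphabet P)) :=
  if is_old (z 1) then shiftn 1 z else shiftn 2 z.

Definition prev_old (z : config (expand_alphabet P)) :=
  if is_old (z (-1)) then shiftn (-1) z else shiftn (-2) z.

Lemma next_old_well z : well_expanded z -> well_expanded (next_old z).
Proof.
move=> [zs z0]; rewrite /next_old; case: ifP => z1; split.
- by move=> i; rewrite /shiftn addrAC.
- by rewrite /shiftn add0r.
- by move=> i; rewrite /shiftn addrAC.
- rewrite /shiftn add0r; have := zs 1; rewrite -[1 + 1]/(2 : int).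
  by move: z1; case: (z 1) => //; case: (z 2).
Qed.

Lemma prev_old_well z : well_expanded z -> well_expanded (prev_old z).
Proof.
move=> [zs z0]; rewrite /prev_old; case: ifP => z1; split.
- by move=> i; rewrite /shiftn addrAC.
- by rewrite /shiftn add0r.
- by move=> i; rewrite /shiftn addrAC.
- rewrite /shiftn add0r; have := zs (-2); rewrite -[-2 + 1]/(-1 : int).
  by move: z1; case: (z (-1)) => //; case: (z (-2)).
Qed.

Lemma prev_oldK z : well_expanded z -> next_old (prev_old z) = z.
Proof.
move=> [zs z0]; rewrite /prev_old; case: ifP => z1; rewrite /next_old /shiftn.
  by rewrite addrN z0; apply/funext => i; rewrite addrK.
rewrite -[1 + - 2]/(-1 : int) z1; apply/funext => i.
by rewrite /shiftn addrK.
Qed.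

Lemma next_oldE z : well_expanded z ->
  next_old z = shiftn (len (old_letter (z 0)))%:Z z.
Proof.
move=> [zs z0]; rewrite /next_old size_tilde; have := zs 0; rewrite add0r.
move: z0; case: (z 0) => //= a _; case: (z 1) => [b|s] /=; first by move/negbTE->.
by move=> /eqP <-; rewrite (valP s).
Qed.

(* [b] lists the shifts of [z] that start at an old letter, in order. *)
Lemma expand_config_old_letters (z : config (expand_alphabet P)) :
  well_expanded z -> exists x, expand_config P x = z.
Proof.
move=> zw; pose b n := match n with
  | Posz n => iter n next_old z | Negz n => iter n.+1 prev_old z end.
have bw n : well_expanded (b n).
  case: n => n /=; elim: n => [|n IH] //=; first exact: next_old_well.
    exact: prev_old_well.
  exact: prev_old_well.
have bS n : b (n + 1) = next_old (b n).
  case: n => [n|[|n]]; first by rewrite -PoszD addn1.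
    by rewrite /= prev_oldK.
  have -> : Negz n.+1 + 1 = Negz n by lia.
  by rewrite [RHS]/= prev_oldK//; exact: (bw (Negz n)).
exists (fun n => old_letter (b n 0)).
(* Both [x] and the list [c] are generalized: the induction passes to the next old letter, and
   coordinate [j + 1] becomes [j + 1 - len (x 0)], unless it is the new symbol right after an
   expanded letter. *)
have nonneg (m : nat) : forall x c, (forall n, well_expanded (c n)) ->
    (forall n, c (n + 1) = next_old (c n)) ->
    (forall n : int, x n = old_letter (c n 0)) ->
    forall j : nat, (j < m)%N -> expand_config P x j%:Z = c 0 j%:Z.
  elim: m => // m IH x c cw cS xE [_|j jm].
    rewrite expand_config0 xE.
    by have [_] := cw 0; case: (c 0 0).
  have := IH (shiftn 1 x) (fun n => c (n + 1)) _ _ _ (j.+1 - len (x 0))%N.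
  have [jx|xj] := ltnP j.+1 (len (x 0)).
    move: (jx); rewrite size_tilde; case: ifP => // Px; case: j {jm jx} => // _ _.
    rewrite (expand_config1 Px); have [cs c0] := cw 0; have := cs 0; rewrite add0r.
    move: Px c0; rewrite xE; case: (c 0 0) => //= a Pa _.
    case: (c 0 1) => [|s] /=; first by rewrite Pa.
    by move=> /eqP E; congr inr; apply: val_inj.
  move=> H; have {H} := H (fun n => cw (n + 1)) (fun n => cS (n + 1))
     (fun n => xE (n + 1)).
  rewrite expand_config_shiftS -PoszD subnK// => ->; last first.
    by rewrite ltn_subLR// addnC (leq_trans jm)// -addn1 leq_add2l.
  by rewrite cS next_oldE// -xE /shiftn -PoszD subnK.
have all_pos x c j (j0 : 0 <= j) : (forall n, well_expanded (c n)) ->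
    (forall n, c (n + 1) = next_old (c n)) ->
    (forall n : int, x n = old_letter (c n 0)) -> expand_config P x j = c 0 j.
  case: j j0 => // j _ cw cS xE; exact: (nonneg j.+1).
suff neg (m : nat) : forall x c, (forall n, well_expanded (c n)) ->
    (forall n, c (n + 1) = next_old (c n)) ->
    (forall n : int, x n = old_letter (c n 0)) ->
    forall j : int, - m%:Z <= j -> expand_config P x j = c 0 j.
  by apply/funext => j; apply: (neg (absz j) _ b) => //; lia.
elim: m => [|m IH] x c cw cS xE j mj; first by apply: all_pos => //; lia.
have [j0|j0] := leP 0 j; first exact: all_pos.
rewrite expand_config_shiftN (IH _ (fun n => c (n - 1)))//.
- have := cS (0 - 1); rewrite subrK => ->.
  by rewrite next_oldE// -xE add0r.
- by move=> n; rewrite -addrAC cS.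
- by move=> n; rewrite /shiftn xE.
- by case: (len (x (- 1))) (size_tilde_gt0 (x (- 1))) => // l _; lia.
Qed.

End ExpandConfig.

Section SymbolExpansion.
Variables (X : shift_space) (P : pred (alphabet X)).

Lemma expand_point_subproof (x : X) :
  expand_config P (val x) \in points (symbol_expansion X P).
Proof.
by apply/mem_set; left; exists (val x) => //; exact: set_mem (valP x).
Qed.

Definition expand_point (x : X) : symbol_expansion X P :=
  exist _ (expand_config P (val x)) (expand_point_subproof x).

Definition expand_height (x : X) : nat := size (tilde P (val x 0)).

Lemma expand_tower : tower expand_point expand_height.
Proof.
split.
- by move=> j x0; have [r rP] := expand_config_near P (val x0) j; exists r => x /rP.
- by move=> x0; exists 0%N => x x0x; rewrite /expand_height x0x.
- by move=> x; exact: size_tilde_gt0.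
- by move=> x; apply: pt_inj; exact: expand_config_shift.
- move=> w; have [[x Xx wE]|[_ [x Xx <-] wE]] := set_mem (valP w).
    exists (exist _ x (mem_set Xx)), 0%N; split; first exact: size_tilde_gt0.
    by apply: pt_inj; rewrite -[LHS]wE sh0.
  case Px: (P (x 0)).
    exists (exist _ x (mem_set Xx)), 1%N; split; last by apply: pt_inj; rewrite -[LHS]wE.
    by rewrite /expand_height size_tilde /= Px.
  exists (sh 1 (exist _ x (mem_set Xx))), 0%N; split; first exact: size_tilde_gt0.
  apply: pt_inj; rewrite -[LHS]wE sh0 /= expand_config_shift size_tilde Px //.
move=> x x' j j'; rewrite /expand_height !size_tilde => jr jr' E.
(* The letter at 0 reveals the floor: it is old on floor 0 and new on floor 1. *)
have E0 : expand_config P (val x) j%:Z = expand_config P (val x') j'%:Z.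
  by have := congr1 (fun w : symbol_expansion X P => val w 0) E; rewrite /= /shiftn !add0r.
suff jj' : j = j'.
  by move: E; rewrite jj' => /sh_inj [] /expand_config_inj /pt_inj.
move: jr jr' E0; case: ifP => Px; case: ifP => Px'.
- case: j {E} => [|[|//]] _; case: j' => [|[|//]] _ //.
    by rewrite (expand_config1 Px').
  by rewrite (expand_config1 Px).
- case: j {E} => [|[|//]] _; case: j' => [|//] _ //.
  by rewrite (expand_config1 Px).
- case: j {E} => [|//] _; case: j' => [|[|//]] _ //.
  by rewrite (expand_config1 Px').
- by case: j {E} => [|//] _; case: j' => [|//].
Qed.

Lemma symbol_expansion_step (w : symbol_expansion X P) (i : int) :
  expand_step (val w i) (val w (i + 1)).
Proof.
have [x [j [jr E]]] := tower_surj expand_tower (sh i w).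
have -> : val w i = val (sh i w) 0 by rewrite /= /shiftn add0r.
have -> : val w (i + 1) = val (sh i w) 1 by rewrite /= /shiftn addrC.
rewrite E /= /shiftn add0r; move: jr; rewrite /expand_height size_tilde.
case: ifP => Px; case: j {E} => [|[|//]] // _; try exact: expand_config_step01.
exact: expand_config_step12.
Qed.

(** Windows of length 2n control windows of length n once the new symbols are removed, and the extra
    2 ensures that [expand_step] is checked even for n = 0. A configuration obeying [expand_step] is
    an expansion, up to a shift by one. *)
Lemma symbol_expansion_finite_type :
  shift_of_finite_type X -> shift_of_finite_type (symbol_expansion X P).
Proof.
move=> /shift_of_finite_typeP[n nP]; apply/shift_of_finite_typeP.
exists (n.*2 + 2)%N => z zP.
have zs i : expand_step (z i) (z (i + 1)).
  have [w wz] := zP i; rewrite -[z i]/(z i) -[i in z i]addr0 -(wz 0%N)//.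
    by rewrite -(wz 1%N)//; [exact: (symbol_expansion_step w 0)|lia].
  by lia.
(* Stated for translates [y] of [z]: if [z] has a new symbol at 0, the translate that starts one
   place earlier begins with an old one. *)
have old (y : config (expand_alphabet P)) : (forall i, exists m,
    forall j, y (i + j) = z (m + j)) -> is_old (y 0) ->
    points (symbol_expansion X P) y.
  move=> yz y0; have [x xy] : exists x, expand_config P x = y.
    apply: expand_config_old_letters; split=> // i.
    by have [m mP] := yz i; rewrite -[i in y i]addr0 !mP addr0; exact: zs.
  left; exists x => //; apply: nP => i.
  have [m mP] := expand_config_shiftn P x i.
  have [m' m'P] := yz m; have [w wz] := zP m'.
  have E (k : nat) : (k < n.*2 + 2)%N ->
      val w k%:Z = expand_config P (shiftn i x) k%:Z.
    by move=> kn; rewrite mP xy [k%:Z + m]addrC m'P wz.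
  have [x' [j [jr wE]]] := tower_surj expand_tower w.
  (* The window begins with an old letter, so the point of the expansion that matches it is on floor
     0 and can be decoded from there. *)
  have j0 : j = 0%N.
    have := E 0%N; rewrite wE addn2 => /(_ isT); rewrite expand_config0 /= /shiftn add0r.
    move: jr; rewrite /expand_height size_tilde; case: ifP => Px; last by case: (j).
    by case: (j) => [|[|//]] // _; rewrite (expand_config1 Px).
  exists x' => k kn; have := @expand_config_window _ P n (val x') (shiftn i x) _ k kn.
  rewrite /shiftn addrC; apply => {k}k {}kn.
  by rewrite -E ?wE ?j0 ?sh0//; lia.
case z0 : (is_old (z 0)).
  by apply: old => // i; exists i.
have := zs (-1); rewrite addNr; case zN: (z (-1)) => [a|s]; case: (z 0) z0 => // s _ _.
rewrite -(Defs.shift0 z) -(addNr 1) addrC -shiftD; apply: shift_points.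
apply: old; last by rewrite /shiftn add0r zN.
by move=> i; exists (i - 1) => j; rewrite /shiftn addrAC.
Qed.

End SymbolExpansion.

Section ExpandMapTower.
Variables (Y X : shift_space) (L : alphabet Y -> alphabet X) (f : Y -> X).
Variables (fL : one_block L f) (P : pred (alphabet X)).

Lemma expand_map_point (y : Y) :
  expand_map fL P (expand_point (preim L P) y) = expand_point P (f y).
Proof. by apply: pt_inj; apply/funext => i; exact: expand_config_map. Qed.

Lemma expand_height_map (y : Y) :
  expand_height (preim L P) y = expand_height P (f y).
Proof. by rewrite /expand_height !size_tilde /= fL. Qed.

Lemma expand_map_sliding : sliding_block_code (expand_map fL P).
Proof.
apply/sliding_block_codeP; split; last by move=> n z; apply: pt_inj.
by move=> j z0; exists (absz j) => z zz0 /=; rewrite zz0.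
Qed.

Lemma expand_map_factor : factor_map f -> factor_map (expand_map fL P).
Proof.
move=> [/sliding_block_codeP[fl fe] fs]; split; first exact: expand_map_sliding.
move=> w; have [x [j [_ ->]]] := tower_surj (expand_tower P) w.
have [y <-] := fs x; exists (sh j%:Z (expand_point (preim L P) y)).
by rewrite -expand_map_point; apply: pt_inj.
Qed.
End ExpandMapTower.

(** * Covers under a conjugacy and under one symbol expansion *)

Section CoverSteps.
Variables (R : realType) (c : shift_cover).
Hypotheses (hcan : canonical_cover c) (hexp : respects_symbol_expansion c).

(** Canonicity supplies the conjugacy of covers, and conjugacies are towers of height one, so the
    naturality of towers applies. *)
Lemma cover_conjugacy (X W : shift_space) (phi : X -> W) :
  irreducible_sofic X -> conjugacy phi ->
  irreducible_sofic W /\ orbit_equivalent_codes R (cover_map c X) (cover_map c W).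
Proof.
move=> iX cphi; have iW := conjugacy_irreducible_sofic cphi iX; split=> //.
have [psi [[cpsi E] _]] := hcan iX iW cphi.
apply: (@tower_orbit_equivalent_codes R _ _ _ _ _ _ psi phi (fun=> 1%N)) => //.
- by have [] := cover_factor_map c iX.
- by have [] := cover_factor_map c iW.
- exact: conjugacy_tower.
- exact: conjugacy_tower.
Qed.

Lemma cover_symbol_expansion (X : shift_space) (a : alphabet X) :
  irreducible_sofic X -> irreducible_sofic (symbol_expansion X (pred1 a)) /\
  orbit_equivalent_codes R (cover_map c X)
    (cover_map c (symbol_expansion X (pred1 a))).
Proof.
move=> iX; have [L [piL La]] := hexp iX; have [phi [cphi phiE]] := La a.
have iE : irreducible_sofic (symbol_expansion X (pred1 a)).
  split; first by case: iX => irr _; exact: tower_irreducible (expand_tower _) irr.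
  (* The expansion stays sofic because the expanded cover is of finite type and maps onto it. *)
  exists (symbol_expansion (c X) (preim L (pred1 a))), (expand_map piL (pred1 a)).
  split; last by apply: expand_map_factor; exact: cover_factor_map.
  by apply: symbol_expansion_finite_type; exact: cover_finite_type.
split=> //.
have [g [cg phiK gK]] := conjugacy_inv cphi.
(* Expanding all preimages of [a] in the cover gives it the heights pulled back from X. The
   conjugacy assumed of the cover then replaces the expanded map by the cover map of the
   expansion. *)
have step1 : orbit_equivalent_codes R (cover_map c X) (expand_map piL (pred1 a)).
  apply: (@tower_orbit_equivalent_codes R _ _ _ _ _ _
    (expand_point (preim L (pred1 a))) (expand_point (pred1 a))
    (expand_height (pred1 a))).
  - by have [] := cover_factor_map c iX.
  - exact: expand_map_sliding.
  - have := expand_tower (preim L (pred1 a)).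
    have -> : expand_height (preim L (pred1 a)) = expand_height (pred1 a) \o cover_map c X.
      by apply/funext => y; exact: expand_height_map.
    by [].
  - exact: expand_tower.
  - by apply/funext => y; exact: expand_map_point.
apply: orbit_equivalent_codes_trans step1 _.
apply: (@tower_orbit_equivalent_codes R _ _ _ _ _ _ g id (fun=> 1%N)).
- exact: expand_map_sliding.
- by have [] := cover_factor_map c iE.
- exact: conjugacy_tower.
- apply: conjugacy_tower; apply: conjugacyP => // [j x0|w]; last by exists w.
  by exists (absz j) => x; apply.
- by apply/funext => z /=; rewrite -phiE /= gK.
Qed.

End CoverSteps.

(** * Covers along towers *)

(* Locality of [g] can be tested in the coordinates (x, j) of the tower, because
   these depend locally on the point sigma^j (k x). *)
Lemma tower_local_code (X V W : shift_space) (k : X -> V) (s : X -> nat)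
    (g : V -> W) : tower k s ->
  (forall (j : nat) (i : int) (x0 : X), (j < s x0)%N -> exists r : nat,
     forall x : X, agree r (val x0) (val x) ->
       val (g (sh j%:Z (k x))) i = val (g (sh j%:Z (k x0))) i) ->
  local_code g.
Proof.
move=> ks gl i v0.
have [M MP] : exists M, forall n x, (M <= n)%N -> (s x <= n)%N.
  apply: points_compact_induction => x0; have [r rP] := tower_height ks x0.
  by exists r, (s x0) => n x xn /rP ->.
(* On each floor there are two cases: near a point above [v0] the assumed locality applies, and
   elsewhere one coordinate already separates the floor from [v0]. Heights are bounded by [M], so
   finitely many floors matter. *)
have jP (j : nat) : exists N, forall n (x : X), (N <= n)%N -> (j < s x)%N ->
    agree n (val v0) (val (sh j%:Z (k x))) ->
    val (g (sh j%:Z (k x))) i = val (g v0) i.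
  apply: points_compact_induction => x0; have [q qP] := tower_height ks x0.
  have [jx|xj] := ltnP j (s x0); last first.
    by exists q, 0%N => n x _ /qP ->; rewrite ltnNge xj.
  have [<-|/eqP kv] := eqVneq (sh j%:Z (k x0)) v0.
    by have [r rP] := gl j i x0 jx; exists r, 0%N => n x _ /rP.
  have [l vl] : exists l, val v0 l <> val (sh j%:Z (k x0)) l.
    apply: contrapT => h; apply: kv; apply: pt_inj; apply/funext => l.
    by apply: contrapT => xl; apply: h; exists l => /esym.
  have [r rP] := tower_code ks (l + j%:Z) x0.
  exists r, (absz l) => n x ln /rP kx _ /(_ l ln) kxv.
  by exfalso; apply: vl; rewrite -kxv /= /shiftn.
have [N NP] := choice jP.
exists (\max_(j < M) N j)%N => v v0v.
have [x [j [jx vE]]] := tower_surj ks v.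
rewrite vE; apply: (NP j (\max_(j < M) N j)%N) => //; last by rewrite -vE.
have jM : (j < M)%N by apply: leq_trans jx (MP M x (leqnn M)).
exact: (@leq_bigmax_cond _ predT (fun j : 'I_M => N j) (Ordinal jM)).
Qed.

Lemma tower_conjugacy (X' X W : shift_space) (g : X' -> X) (h : X -> W)
    (r : X -> nat) : conjugacy g -> tower h r -> tower (h \o g) (r \o g).
Proof.
move=> [/sliding_block_codeP[gl ge] [g' [_ gK g'K]]] hr; split.
- exact: local_code_comp gl (tower_code hr).
- exact: local_code_locally_constant gl (tower_height hr).
- by move=> x; exact: tower_gt0 hr _.
- by move=> x /=; rewrite ge (tower_return hr).
- move=> w; have [x [j [jx ->]]] := tower_surj hr w.
  by exists (g' x), j; rewrite /= g'K.
- by move=> x x' j j' /= jx jx' /(tower_inj hr) -/(_ jx jx')[/(can_inj gK)].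
Qed.

Section ImageShift.
Variables (X : shift_space) (B : finType) (k : X -> config B).
Hypothesis kl : forall i, locally_constant (fun x => k x i).
Hypothesis ke : forall x, k (sh 1 x) = shiftn 1 (k x).

Lemma image_shift_closed : closed (range k).
Proof.
apply: compact_closed; first exact: config_hausdorff.
apply: continuous_compact; last exact: points_compact.
apply: continuous_subspaceT; apply: continuous_prod_topology => i.
apply: locally_constant_continuous => x; have [r rP] := kl i x.
by apply/nbhs_points; exists r.
Qed.

Lemma image_shift_invariant : shiftn 1 @` range k = range k.
Proof.
rewrite eqEsubset; split=> [_ [_ [x _ <-] <-]|_ [x _ <-]].
  by exists (sh 1 x).
exists (k (sh (-1) x)); first by exists (sh (-1) x).
by rewrite -ke shD subrr sh0.
Qed.

Definition image_shift : shift_space :=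
  ShiftSpace image_shift_closed image_shift_invariant.

Definition to_image_shift (x : X) : image_shift :=
  exist _ (k x) (mem_set (ex_intro2 _ _ x Logic.I erefl)).

(** This allows letters to be enriched by any locally constant finite data without leaving the
    conjugacy class. *)
Lemma to_image_shift_conjugacy : injective k -> conjugacy to_image_shift.
Proof.
move=> kinj; apply: conjugacyP.
- by move=> i x0; exact: kl.
- by move=> x; apply: pt_inj; exact: ke.
- by move=> x y E; apply: kinj; exact: (congr1 (fun z : image_shift => val z) E).
- by move=> w; have [x _ xw] := set_mem (valP w); exists x; apply: pt_inj.
Qed.
End ImageShift.

Section CoverTower.
Variables (R : realType) (c : shift_cover).
Hypotheses (hcan : canonical_cover c) (hexp : respects_symbol_expansion c).

(* If [W] is a tower over [X] of height [rho (x 0)], it is a tower over e_a(X)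
   of height [expand_rho rho]: one floor above [a] is absorbed in the base. *)
Definition expand_rho (A : finType) (a : A) (rho : A -> nat)
    (d : expand_alphabet (pred1 a)) : nat :=
  match d with
  | inl b => if b == a then 1%N else rho b
  | inr _ => (rho a).-1
  end.

(** The measure of the induction: the height [rho a] is shared out as 1 for [a] and [rho a - 1] for
    its new symbol, which lowers the total excess over 1 by one. *)
Lemma sum_expand_rho (A : finType) (a : A) (rho : A -> nat) : (1 < rho a)%N ->
  (\sum_(d : expand_alphabet (pred1 a)) (expand_rho rho d).-1).+1 =
  (\sum_b (rho b).-1)%N.
Proof.
move=> ra; rewrite big_sumType /= [in RHS](bigD1 a)//= (bigD1 a)//= eqxx add0n.
rewrite sum_nat_const card_sig card1 mul1n -addnS addnC.
have -> : ((rho a).-2.+1 = (rho a).-1)%N by case: (rho a) ra => [|[]].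
by congr addn; apply: eq_bigr => b /negbTE ->.
Qed.

Lemma expand_tower_below (X W : shift_space) (h : X -> W) (r : X -> nat)
    (rho : alphabet X -> nat) (a : alphabet X) :
  tower h r -> (forall x : X, r x = rho (val x 0)) -> (1 < rho a)%N ->
  exists h' : symbol_expansion X (pred1 a) -> W,
    tower h' (fun w => expand_rho rho (val w 0)).
Proof.
move=> hr rE ra; have ht := expand_tower (pred1 a).
have pick (w : symbol_expansion X (pred1 a)) : exists p : X * nat,
    (p.2 < expand_height (pred1 a) p.1)%N /\
    w = sh p.2%:Z (expand_point (pred1 a) p.1).
  by have [x [j ?]] := tower_surj ht w; exists (x, j).
have [p pP] := choice pick.
(* The floor [j] above [x] in the expansion goes to the floor [j] above [h x]; floor coordinates are
   unique, so this is well determined. *)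
pose h' w := sh (p w).2%:Z (h (p w).1).
have h'E x (j : nat) : (j < expand_height (pred1 a) x)%N ->
    h' (sh j%:Z (expand_point (pred1 a) x)) = sh j%:Z (h x).
  move=> jx; have [] := pP (sh j%:Z (expand_point (pred1 a) x)).
  by rewrite /h'; move=> px /(tower_inj ht) -/(_ jx px)[<- <-].
have heightE x : expand_height (pred1 a) x = if val x 0 == a then 2%N else 1%N.
  by rewrite /expand_height size_tilde.
have cases w : exists x j, [/\ w = sh j%:Z (expand_point (pred1 a) x),
    h' w = sh j%:Z (h x), (j < expand_height (pred1 a) x)%N &
    expand_rho rho (val w 0) =
      if val x 0 == a then (if j == 0%N then 1%N else (rho a).-1) else rho (val x 0)].
  have [x [j [jx wE]]] := tower_surj ht w; exists x, j; split => //.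
    by rewrite wE h'E.
  rewrite wE /= /shiftn add0r; move: jx; rewrite heightE; case: ifP => xa.
    case: j {wE} => [|[|//]] _; first by rewrite expand_config0 /= xa.
    by rewrite (@expand_config1 _ (pred1 a) (val x) xa).
  by case: j {wE} => [|//] _; rewrite expand_config0 /= xa.
exists h'; split.
- apply: (tower_local_code ht) => j i x0 jx0.
  have [q qP] := tower_height ht x0; have [q' q'P] := tower_code hr (i + j%:Z) x0.
  exists (q + q')%N => x x0x; rewrite !h'E//; last first.
    by rewrite qP//; apply: agreeW x0x; lia.
  by rewrite /= /shiftn q'P//; apply: agreeW x0x; lia.
- by move=> w0; exists 0%N => w ->.
- move=> w; have [x [j [_ _ _ ->]]] := cases w.
  have := tower_gt0 hr x; rewrite rE; case: ifP => // _ _.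
  by case: ifP => // _; lia.
- move=> w; have [x [j [wE -> jx ->]]] := cases w.
  have ret : sh (rho (val x 0))%:Z (h x) = h (sh 1 x).
    by rewrite (tower_return hr) rE.
  have ret' : sh (expand_height (pred1 a) x)%:Z (expand_point (pred1 a) x) =
     expand_point (pred1 a) (sh 1 x) by rewrite (tower_return ht).
  have h'S : h' (expand_point (pred1 a) (sh 1 x)) = h (sh 1 x).
    by have := h'E (sh 1 x) 0%N (tower_gt0 ht _); rewrite !sh0.
  rewrite wE shD; move: jx ret'; rewrite heightE; case: ifP => xa.
    case: j {wE} => [|[|//]] _ ret' /=.
      by rewrite addr0 (h'E x 1%N) ?heightE ?xa// sh0.
    rewrite ret' h'S -ret (eqP xa) shD; congr sh; lia.
  by case: j {wE} => [|//] _ ret' /=; rewrite addr0 ret' h'S sh0 ret.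
- move=> w; have [x [j [jx ->]]] := tower_surj hr w; move: jx; rewrite rE => jx.
  case xa : (val x 0 == a); last first.
    exists (expand_point (pred1 a) x), j; split; first by rewrite /= xa.
    by have := h'E x 0%N (tower_gt0 ht _); rewrite !sh0 => ->.
  case: j jx => [|j] jx.
    exists (expand_point (pred1 a) x), 0%N; split; first by rewrite /= xa.
    by have := h'E x 0%N (tower_gt0 ht _); rewrite !sh0 => ->.
  exists (sh 1 (expand_point (pred1 a) x)), j.
  rewrite (h'E x 1%N) ?heightE ?xa//; split; last by rewrite shD; congr sh; lia.
  rewrite /= /shiftn add0r (@expand_config1 _ (pred1 a) (val x) xa) /=.
  by rewrite (eqP xa) in jx; lia.
- move=> v v' i i'.
  have [x [j [-> -> jx ->]]] := cases v; have [x' [j' [-> -> jx' ->]]] := cases v'.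
  (* Floor [n] over the expanded point [(y, m)] is floor [n + m] over [y], and [m] is recovered from
     the total by truncation, because the floor over an old [a] has height 1. *)
  have total (y : X) (m n : nat) : (m < expand_height (pred1 a) y)%N ->
      (n < (if val y 0 == a then (if m == 0%N then 1%N else (rho a).-1)
            else rho (val y 0)))%N ->
      (n + m < r y)%N /\ (m = minn (n + m) (expand_height (pred1 a) y).-1)%N.
    rewrite heightE rE; case: ifP => [/eqP ->|_]; case: m => [|[|//]]//=;
      by move=> *; split; rewrite ?addn0 ?addn1; try lia; assumption.
  move=> /(total _ _ _ jx)[ijx jE] /(total _ _ _ jx')[ijx' jE'].
  rewrite !shD -!PoszD => /(tower_inj hr) -/(_ ijx ijx')[xx' ijE].
  have jj' : j = j' by rewrite jE jE' ijE xx'.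
  by rewrite xx' jj'; split => //; lia.
Qed.

(** Induction on the total excess height of the letters, including letters that do not occur in [X].
    With no excess [h] is a conjugacy; otherwise a letter of height at least 2 is expanded. *)
Lemma cover_tower_letter n : forall (X W : shift_space) (h : X -> W)
    (r : X -> nat) (rho : alphabet X -> nat),
  irreducible_sofic X -> tower h r -> (forall x : X, r x = rho (val x 0)) ->
  (\sum_a (rho a).-1 <= n)%N ->
  irreducible_sofic W /\ orbit_equivalent_codes R (cover_map c X) (cover_map c W).
Proof.
elim: n => [|n IH] X W h r rho iX hr rE sumn.
  have r1 (x : X) : r x = 1%N.
    have := tower_gt0 hr x; rewrite rE; move: sumn.
    rewrite (bigD1 (val x 0))//=; set b := rho _; set d := (\sum_(i | _) _)%N.
    by case: b => [|[]].
  apply: (@cover_conjugacy R c hcan X W h iX); apply: conjugacyP.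
  - exact: tower_code hr.
  - by move=> x; rewrite (tower_return hr) r1.
  - move=> x y E; have := @tower_inj _ _ _ _ hr x y 0%N 0%N.
    by rewrite !r1 !sh0 => /(_ isT isT E)[].
  - move=> w; have [x [j []]] := tower_surj hr w; rewrite r1.
    by case: j => // _ ->; exists x; rewrite sh0.
have [[a ra]|no] := pselect (exists a, (1 < rho a)%N); last first.
  apply: (IH X W h r rho) => //; rewrite big1 // => a _.
  have : ~ (1 < rho a)%N by move=> ra; apply: no; exists a.
  by case: (rho a) => [|[]].
have [h' h'r] := expand_tower_below hr rE ra.
have [iE oe] := @cover_symbol_expansion R c hexp X a iX.
have [|iW oe'] := IH _ W h' _ (expand_rho rho) iE h'r (fun=> erefl).
  by rewrite -ltnS sum_expand_rho.
by split => //; exact: orbit_equivalent_codes_trans oe oe'.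
Qed.

(* Recording r(sigma^i x) next to x_i makes the height depend on x_0 only. *)
Lemma cover_tower (X W : shift_space) (h : X -> W) (r : X -> nat) :
  irreducible_sofic X -> tower h r ->
  irreducible_sofic W /\ orbit_equivalent_codes R (cover_map c X) (cover_map c W).
Proof.
move=> iX hr.
have [M MP] : exists M, forall n x, (M <= n)%N -> (r x <= n)%N.
  apply: points_compact_induction => x0; have [q qP] := tower_height hr x0.
  by exists q, (r x0) => n x xn /qP ->.
(* The bound [M] makes the enriched alphabet finite and keeps [inord] faithful. *)
pose k (x : X) : config (alphabet X * 'I_M.+1)%type :=
  fun i => (val x i, inord (r (sh i x))).
have kl i : locally_constant (fun x => k x i).
  apply: (@locally_constant2 X _ _ _ (fun x : X => val x i)
    (fun x => inord (r (sh i x)) : 'I_M.+1) pair).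
    by move=> x0; exists (absz i) => x; apply.
  apply: (@locally_constant_comp X _ _ (fun x => r (sh i x)) inord).
  exact: (@local_code_locally_constant X X nat (sh i) r (local_code_sh i)
    (tower_height hr)).
have ke x : k (sh 1 x) = shiftn 1 (k x).
  by apply/funext => i; rewrite /k /shiftn shD.
have kinj : injective k.
  move=> x y E; apply: pt_inj; apply/funext => i.
  by have := congr1 (fun z : config _ => (z i).1) E.
have cto := to_image_shift_conjugacy kl ke kinj.
have [g [cg toK gK]] := conjugacy_inv cto.
have [iI oe] := @cover_conjugacy R c hcan _ _ _ iX cto.
have gr := tower_conjugacy cg hr.
have rE (z : image_shift kl ke) : (r \o g) z = val (val z 0).2.
  rewrite -[z in RHS]gK /= sh0 inordK// ltnS; exact: MP.
pose rho (b : alphabet (image_shift kl ke)) : nat :=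
  val (b : (alphabet X * 'I_M.+1)%type).2.
have [iW oe'] := @cover_tower_letter _ _ _ _ _ rho iI gr rE (leqnn _).
by split => //; exact: orbit_equivalent_codes_trans oe oe'.
Qed.
End CoverTower.

(** * Cross-sections from flow equivalences *)

Lemma int_eq0 (R : realType) (n : int) : `|n%:~R : R| < 1 -> n = 0.
Proof. by rewrite -intr_norm -[X in _ < X]/(1%:~R) ltr_int; lia. Qed.

(** The retraction of the line onto [0, e]. It turns data given on the interval into total
    functions, to which choice and the intermediate value theorem apply. *)
Definition clamp (R : realType) (e s : R) : R :=
  if s < 0 then 0 else if e < s then e else s.

Lemma clamp_ge0 (R : realType) (e s : R) : 0 < e -> 0 <= clamp e s.
Proof. by move=> e0; rewrite /clamp; case: ltP => // ?; case: ltP; lra. Qed.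

Lemma clamp_le (R : realType) (e s : R) : 0 < e -> clamp e s <= e.
Proof. by move=> e0; rewrite /clamp; case: ltP => ?; [lra|case: ltP; lra]. Qed.

Lemma clamp_id (R : realType) (e s : R) : 0 <= s -> s <= e -> clamp e s = s.
Proof. by move=> s0 se; rewrite /clamp ltNge s0 /= ltNge se. Qed.

Lemma clamp_lipschitz (R : realType) (e s t : R) : 0 < e ->
  `|clamp e s - clamp e t| <= `|s - t|.
Proof.
move=> e0; wlog st : s t / s <= t.
  by move=> le; have [/le //|/ltW/le] := leP s t; rewrite distrC [`|t - s|]distrC.
suff /andP[c0 c1] : (0 <= clamp e t - clamp e s) && (clamp e t - clamp e s <= t - s).
  by rewrite distrC [`|s - t|]distrC !ger0_norm// subr_ge0.
rewrite /clamp; have [s0|s0] := ltP s 0; have [t0|t0] := ltP t 0;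
  have [es|se] := ltP e s; have [et|te] := ltP e t; apply/andP; split; lra.
Qed.

Lemma real_continuousP (R : realType) (u : R -> R) :
  (forall s e, 0 < e -> exists2 d, 0 < d &
     forall s', `|s' - s| < d -> `|u s' - u s| < e) -> continuous u.
Proof.
move=> uP s; apply/cvgrPdist_lt => e e0; have [d d0 dP] := uP s e e0.
by apply/nbhs_ballP; exists d => // s' ss' /=; rewrite distrC dP// distrC.
Qed.

(** Connectedness of the line: the indicator of a change of value would be continuous and take the
    value 1/2. *)
Lemma locally_constant_real (R : realType) (T : Type) (v : R -> T) :
  (forall s, exists2 d, 0 < d & forall s', `|s' - s| < d -> v s' = v s) ->
  forall s t, v s = v t.
Proof.
move=> vP; suff le s t : s <= t -> v s = v t.
  by move=> s t; have [/le|/ltW/le->] := leP s t.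
move=> st; apply: contrapT => vst.
pose w x : R := if `[< v x = v s >] then 0 else 1.
have wc : continuous w.
  apply: real_continuousP => x e e0; have [d d0 dP] := vP x; exists d => // x' /dP E.
  by rewrite /w E subrr normr0.
have ws : w s = 0 by rewrite /w asboolT.
have wt : w t = 1 by rewrite /w asboolF// => E; apply: vst.
have [|z _] := @IVT R w s t (1 / 2) st (continuous_subspaceT wc).
  by rewrite ws wt ge_min le_max; apply/andP; split; apply/orP; [left|right]; lra.
by rewrite /w; case: asboolP => _; lra.
Qed.

(** Each bisection adds one to the guaranteed increase, which would therefore exceed every natural
    number. *)
Lemma strictly_increasing_int (R : realType) (a b : R) (g : R -> R) : a < b ->
  (forall s t, a <= s -> s < t -> t <= b -> g s < g t) ->
  (forall s, a <= s -> s <= b -> exists n : int, g s = n%:~R) -> False.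
Proof.
move=> ab gm gz.
have gap (k : nat) : forall s t, a <= s -> s < t -> t <= b -> g s + k%:R <= g t.
  elim: k => [|k IH] s t as_ st tb; first by rewrite addr0 ltW// gm.
  have := IH s ((s + t) / 2) as_; have := gm ((s + t) / 2) t.
  have [n ->] : exists n : int, g ((s + t) / 2) = n%:~R by apply: gz; lra.
  have [m ->] : exists m : int, g t = m%:~R by apply: gz; lra.
  have [l ->] : exists l : int, g s = l%:~R by apply: gz; lra.
  move=> A B; have {A} : n%:~R < m%:~R :> R by apply: A => //; lra.
  have {B} : l%:~R + k%:R <= n%:~R :> R by apply: B => //; lra.
  rewrite -[k%:R]/((k%:Z)%:~R) -[k.+1%:R]/((k.+1%:Z)%:~R) -!intrD !ler_int ltr_int.
  lia.
have [n nE] := gz a (lexx _) (ltW ab); have [m mE] := gz b (ltW ab) (lexx _).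
have := gap (absz (m - n)).+1 a b (lexx _) ab (lexx _).
rewrite nE mE -[_.+1%:R]/((_.+1%:Z)%:~R) -intrD ler_int; lia.
Qed.

(** * Lifting short image paths to Y x R *)

Section FlowStep.
Variables (R : realType) (X Y : shift_space) (psi : torus R X -> torus R Y).
Hypothesis hpsi : flow_equivalence psi.

Lemma flow0 (Z : shift_space) (q : torus R Z) : flow 0 q = q.
Proof. by have [z [t ->]] := torusP q; rewrite flowE addr0. Qed.

Lemma flowD (Z : shift_space) s t (q : torus R Z) : flow s (flow t q) = flow (s + t) q.
Proof. by have [z [u ->]] := torusP q; rewrite !flowE -addrA [t + s]addrC. Qed.

Lemma flow_equivalence_inj : injective psi.
Proof. by have [[_ [phi [_ psiK _]]] _] := hpsi; exact: can_inj psiK. Qed.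

Lemma flow_equivalence_near (x : X) (t : R) (y : Y) (t' : R) (k : nat) (e : R) :
  0 < e -> psi (torus_class x t) = torus_class y t' ->
  exists (r : nat) (d : R), (0 < d) /\ (forall (x1 : X) (t1 : R),
    agree r (val x) (val x1) -> `|t1 - t| < d -> exists (y1 : Y) (t2 : R),
      [/\ psi (torus_class x1 t1) = torus_class y1 t2, agree k (val y) (val y1) &
          `|t2 - t'| < e]).
Proof.
move=> e0 psiE; have [[psic _] _] := hpsi.
pose U : set (torus R Y) := [set q | exists (y1 : Y) (t2 : R),
  [/\ q = torus_class y1 t2, agree k (val y) (val y1) & `|t2 - t'| < e]].
have : nbhs (psi (torus_class x t)) U.
  by rewrite psiE; apply/nbhs_torus; exists k, e; split => // y1 t1 ? ?; exists y1, t1.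
move=> /psic Uq.
have /nbhs_torus : nbhs (torus_class x t) (psi @^-1` U) by exact: Uq.
by [].
Qed.

Lemma flow_equivalence_forward q s : 0 <= s ->
  exists2 b, 0 <= b & psi (flow s q) = flow b (psi q).
Proof.
move=> s0; have [_ /(_ q)[f [fh fE]]] := hpsi.
exists (f s - f 0); first by rewrite subr_ge0; exact: (ltW_homo fh).
by rewrite -{2}(flow0 q) !fE flowD subrK.
Qed.

(** The image path lifts to a single line {y} x R. A total increase below 1/2 excludes ambiguity by
    integers when lifts are compared. *)
Definition small_step (e : R) (q : torus R X) : Prop :=
  exists (y : Y) (u : R -> R), [/\ continuous u,
    forall s, 0 <= s -> s <= e -> psi (flow s q) = torus_class y (u s),
    forall s t, 0 <= s -> s < t -> t <= e -> u s < u t & u e - u 0 < 1 / 2].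

(* While psi(q) moves inside a chart Y x ]t0 - 1/8, t0 + 1/8[, its Y-coordinate is
   constant because Y is totally disconnected, and its time coordinate is a
   continuous injective function [us]. The given time change [f] may differ from
   [us] by integers (it can jump on periodic orbits), but if [us] were decreasing
   then f - us would be strictly increasing with integer values. *)
Lemma small_step_lift (e t0 : R) (q : torus R X) : 0 < e -> e <= 1 / 2 ->
  (forall s, 0 <= s -> s <= e -> exists (y : Y) (u : R),
     psi (flow s q) = torus_class y u /\ `|u - t0| < 1 / 8) ->
  small_step e q.
Proof.
move=> e0 e2 loc.
have loc' s : exists p : Y * R, psi (flow (clamp e s) q) = torus_class p.1 p.2 /\
    `|p.2 - t0| < 1 / 8.
  have [y [u ?]] := loc _ (clamp_ge0 s e0) (clamp_le s e0).
  by exists (y, u).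
have [p pP] := choice loc'; pose ys s := (p s).1; pose us s := (p s).2.
have psiE s : psi (flow (clamp e s) q) = torus_class (ys s) (us s).
  by have [] := pP s.
have usE s : `|us s - t0| < 1 / 8 by have [] := pP s.
have near s k (d : R) : 0 < d -> exists2 d', 0 < d' & forall s', `|s' - s| < d' ->
    agree k (val (ys s)) (val (ys s')) /\ `|us s' - us s| < d.
  move=> d0; have [x [t qE]] := torusP q.
  (* Two times within 1/8 of [t0] and a perturbation below 1/4 add up to less than 1, so the integer
     between the two lifts is zero. *)
  pose d1 := Num.min d (1 / 4); have d10 : 0 < d1 by rewrite lt_min d0; lra.
  have := psiE s; rewrite {1}qE flowE.
  move=> /(flow_equivalence_near k d10)[r [d' [d'0 d'P]]]; exists d' => // s' ss'.
  have [|y1 [t2 [psi1 yy1 tt2]]] := d'P x (t + clamp e s') (@agree_refl _ r _).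
    rewrite opprD addrACA subrr add0r; apply: le_lt_trans ss'.
    exact: clamp_lipschitz.
  move: psi1; rewrite -flowE -qE psiE => /torus_classE[n [uE y1E]].
  have n0 : n = 0.
    apply: (@int_eq0 R); have := usE s; have := usE s'; move: tt2 uE.
    rewrite lt_min => /andP[_]; rewrite !ltr_norml.
    by move=> /andP[? ?] ? /andP[? ?] /andP[? ?]; apply/andP; lra.
  move: uE y1E; rewrite n0 addr0 sh0 => uE y1E; split; first by rewrite -y1E.
  by rewrite uE; apply: lt_le_trans tt2 _; rewrite ge_min lexx.
have ysE s : ys s = ys 0.
  apply: pt_inj; apply/funext => j.
  apply: (@locally_constant_real R _ (fun s => val (ys s) j)) => s1.
  have [d d0 dP] := near s1 (absz j) 1 ltr01; exists d => // s' /dP[E _].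
  exact: E.
have uc : continuous us.
  apply: real_continuousP => s d d0; have [d' d'0 d'P] := near s 0%N d d0.
  by exists d' => // s' /d'P[].
have liftE s : 0 <= s -> s <= e -> psi (flow s q) = torus_class (ys 0) (us s).
  by move=> s0 se; rewrite -{1}(clamp_id s0 se) psiE ysE.
exists (ys 0), us; split => //; last first.
  by have := usE e; have := usE 0; rewrite !ltr_norml => /andP[? ?] /andP[? ?]; lra.
(* Points at equal lifted time coincide as [psi] is injective, so their times differ by an integer,
   which is zero because [e <= 1 / 2]. *)
have uinj : {in `[0, e] &, injective us}.
  move=> s s'; rewrite !in_itv /= => /andP[s0 se] /andP[s0' se'] E.
  have : psi (flow s q) = psi (flow s' q) by rewrite !liftE// E.
  move=> /flow_equivalence_inj; have [x [t ->]] := torusP q; rewrite !flowE.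
  move=> /torus_classE[n [nE _]]; have n0 : n = 0.
    by apply: (@int_eq0 R); rewrite ltr_norml; apply/andP; lra.
  by move: nE; rewrite n0; lra.
move=> s t s0 st te; rewrite ltNge; apply/negP => ust.
have dec := itv_continuous_inj_ge (ex_intro _ s (ex_intro _ t _))
  (continuous_subspaceT uc) uinj.
have {}dec : {in `[0, e] &, {mono us : x y /~ x <= y}}.
  by apply: dec; rewrite !in_itv /=; split => //; apply/andP; lra.
have [_ /(_ q)[f [fh fE]]] := hpsi.
apply: (@strictly_increasing_int R 0 e (fun s => f s - us s + us 0) e0).
  move=> a b a0 ab be; have := fh _ _ ab.
  have : us b < us a.
    rewrite ltNge dec ?in_itv /= -?ltNge//; apply/andP; lra.
  lra.
move=> a a0 ae; have := fE a.
have psi0 : psi q = torus_class (ys 0) (us 0) by rewrite -liftE ?flow0// ltW.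
rewrite liftE// psi0 flowE => /torus_classE[n [nE _]].
by exists (- n); rewrite rmorphN /=; lra.
Qed.

(** The step has the form 1/(n+1) so that n+1 of them make exactly one unit of time, that is, one
    shift of X. *)
Lemma flow_equivalence_small_step :
  exists n : nat, forall q, small_step (n.+1%:R^-1) q.
Proof.
have [|N NP] := @torus_compact_induction R X (fun n q => small_step (n.+1%:R^-1) q).
  move=> x t; have [y [t' psiE]] := torusP (psi (torus_class x t)).
  have e0 : 0 < 1 / 8 :> R by lra.
  have [r [d [d0 dP]]] := flow_equivalence_near 0 e0 psiE.
  have [N N1] : exists N : nat, N.+1%:R^-1 < Num.min (d / 2) (1 / 2).
    have m0 : 0 < Num.min (d / 2) (1 / 2) by rewrite lt_min; apply/andP; lra.
    exists (Num.truncn (Num.min (d / 2) (1 / 2))^-1).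
    by rewrite invf_plt ?posrE ?ltr0n// truncnS_gt.
  (* Half of [d] is left for the starting time and half for the step. *)
  exists r, (d / 2), N; split; first by lra.
  move=> n x1 t1 Nn xx1 tt1.
  have n1 : n.+1%:R^-1 < Num.min (d / 2) (1 / 2).
    by apply: le_lt_trans N1; rewrite lef_pV2 ?posrE ?ltr0n// ler_nat.
  move: n1; rewrite lt_min => /andP[nd n2].
  apply: (@small_step_lift _ t'); rewrite ?invr_gt0 ?ltr0n//; first exact: ltW.
  move=> s s0 /le_lt_trans/(_ nd) sd; rewrite flowE.
  have [|y1 [t2 [E _ t2E]]] := dP x1 (t1 + s) xx1; last by exists y1, t2.
  by move: tt1; rewrite !ltr_norml => /andP[? ?]; apply/andP; lra.
by exists N => q; exact: NP.
Qed.

(** The advance [d q] is the increase of the lifted time. The intermediate value theorem shows that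
    no target time is skipped; this is what later detects every visit to the section. *)
Lemma flow_equivalence_step : exists (n : nat) (d : torus R X -> R), forall q,
  [/\ 0 < d q, d q < 1 / 2, psi (flow (n.+1%:R^-1) q) = flow (d q) (psi q) &
      forall b, 0 <= b -> b < d q -> exists s, [/\ 0 <= s, s < n.+1%:R^-1,
        psi (flow s q) = flow b (psi q) & s = 0 -> b = 0]].
Proof.
have [n nP] := flow_equivalence_small_step; exists n.
have e0 : 0 < n.+1%:R^-1 :> R by rewrite invr_gt0 ltr0n.
have dP q : exists d, [/\ 0 < d, d < 1 / 2,
    psi (flow (n.+1%:R^-1) q) = flow d (psi q) &
      forall b, 0 <= b -> b < d -> exists s, [/\ 0 <= s, s < n.+1%:R^-1,
        psi (flow s q) = flow b (psi q) & s = 0 -> b = 0]]; last first.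
  by have [d ?] := choice dP; exists d.
have [y [u [uc uE um ud]]] := nP q; set e : R := n.+1%:R^-1 in e0 uE um ud *.
have u0 : psi q = torus_class y (u 0) by rewrite -uE ?flow0// ltW.
have ue : u 0 < u e by apply: um.
exists (u e - u 0); split; first by lra.
- by [].
- by rewrite u0 flowE uE ?(ltW e0)// addrC subrK.
move=> b b0 bd; have [|s] := @IVT R u 0 e (u 0 + b) (ltW e0) (continuous_subspaceT uc).
  by rewrite ge_min le_max; apply/andP; split; apply/orP; [left|right]; lra.
rewrite in_itv /= => /andP[s0 se] usE.
have lt_se : s < e.
  by rewrite lt_neqAle se andbT; apply/eqP => E; move: usE; rewrite E; lra.
exists s; split => //; first by rewrite uE// usE u0 flowE.
by move=> E; move: usE; rewrite E; lra.
Qed.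

(** Both ends of the step move little with the starting point, which fixes the advance up to a small
    error and an integer; advances below 1/2 force that integer to be zero. *)
Lemma step_continuous (e : R) (d : torus R X -> R) :
  (forall q, [/\ 0 < d q, d q < 1 / 2 & psi (flow e q) = flow (d q) (psi q)]) ->
  forall (x : X) (t eps : R), 0 < eps -> exists (r : nat) (del : R), 0 < del /\
    forall (x1 : X) (t1 : R), agree r (val x) (val x1) -> `|t1 - t| < del ->
      `|d (torus_class x1 t1) - d (torus_class x t)| < eps.
Proof.
move=> dP x t eps eps0; have [y [t' psiE]] := torusP (psi (torus_class x t)).
pose e1 := Num.min (eps / 2) (1 / 8).
have e10 : 0 < e1 by rewrite lt_min; apply/andP; lra.
have [d0 d1 dE] := dP (torus_class x t).
have psiE' : psi (torus_class x (t + e)) = torus_class y (t' + d (torus_class x t)).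
  by rewrite -flowE dE psiE flowE.
have [r [del [del0 delP]]] := flow_equivalence_near 0 e10 psiE.
have [r' [del' [del0' delP']]] := flow_equivalence_near 0 e10 psiE'.
exists (r + r')%N, (Num.min del del'); split; first by rewrite lt_min del0.
move=> x1 t1 xx1; rewrite lt_min => /andP[tt1 tt1'].
have [||y1 [t2 [E1 _ tt2]]] := delP x1 t1 => //.
  exact: agreeW (leq_addr _ _) xx1.
have [||y2 [t3 [E2 _ tt3]]] := delP' x1 (t1 + e).
- exact: agreeW (leq_addl _ _) xx1.
- by rewrite opprD addrACA subrr addr0.
have [c0 c1 cE] := dP (torus_class x1 t1).
move: E2; rewrite -flowE cE E1 flowE => /torus_classE[n [nE _]].
move: tt2 tt3; rewrite !lt_min !ltr_norml.
move=> /andP[/andP[? ?] /andP[? ?]] /andP[/andP[? ?] /andP[? ?]].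
have n0 : n = 0 by apply: (@int_eq0 R); rewrite ltr_norml; apply/andP; lra.
by move: nE; rewrite n0 => nE; apply/andP; lra.
Qed.
End FlowStep.

(** * The cross-section and its return time *)

Section FlowSection.
Variable R : realType.

Definition real_local (X : shift_space) (g : X -> R) : Prop :=
  forall (x0 : X) (eps : R), 0 < eps -> exists r : nat, forall x : X,
    agree r (val x0) (val x) -> `|g x - g x0| < eps.

(* [q] parametrizes by [X] a cross-section of the flow on the torus of [Y], with
   return time [tau] and first return map the shift of [X]. *)
Record flow_section (X Y : shift_space) (q : X -> torus R Y) (tau : X -> R) : Prop :=
  FlowSection {
  section_near : forall (x0 : X) (y : Y) (t : R) (k : nat) (e : R), 0 < e ->
    q x0 = torus_class y t -> exists r : nat, forall x : X,
    agree r (val x0) (val x) -> exists (y1 : Y) (t1 : R),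
      [/\ q x = torus_class y1 t1, agree k (val y) (val y1) & `|t1 - t| < e];
  section_time : real_local tau;
  section_return : forall x, q (sh 1 x) = flow (tau x) (q x);
  section_surj : forall w, exists x b, 0 <= b /\ w = flow b (q x);
  section_inj : forall x x' b, 0 <= b -> q x' = flow b (q x) -> exists k : nat,
    x' = sh k%:Z x /\ b = \sum_(i < k) tau (sh i%:Z x) }.

Lemma real_local_sum (X : shift_space) (n : nat) (g : nat -> X -> R) :
  (forall i, real_local (g i)) -> real_local (fun x => \sum_(i < n) g i x).
Proof.
move=> gl; elim: n => [|n IH] x0 eps eps0.
  by exists 0%N => x _; rewrite !big_ord0 subrr normr0.
have eps2 : 0 < eps / 2 by lra.
have [r rP] := IH x0 _ eps2; have [s sP] := gl n x0 _ eps2.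
exists (r + s)%N => x x0x; rewrite !big_ord_recr /= opprD addrACA.
apply: le_lt_trans (ler_normD _ _) _; rewrite (splitr eps) ltrD//.
  by apply: rP; apply: agreeW x0x; lia.
by apply: sP; apply: agreeW x0x; lia.
Qed.

Lemma big_ord_addn (n k : nat) (F : nat -> R) :
  \sum_(i < n + k) F i = \sum_(i < n) F i + \sum_(i < k) F (n + i)%N.
Proof. by rewrite big_split_ord /=. Qed.

Lemma partial_sum_bracket (F : nat -> R) (b : R) (K : nat) :
  0 <= b -> b < \sum_(i < K) F i -> exists k,
  (\sum_(i < k) F i <= b) /\ (b < \sum_(i < k) F i + F k).
Proof.
move=> b0; elim: K => [|K IH]; first by rewrite big_ord0; lra.
rewrite big_ord_recr /= => bK.
by have [le|/IH] := leP (\sum_(i < K) F i) b; first by exists K.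
Qed.

(** The section is the image of X x {0} and a return consists of n+1 small steps. For [section_inj],
    the time [b] is bracketed between consecutive partial sums of advances and pulled back to the
    torus of X. *)
Lemma flow_equivalence_section (X Y : shift_space) (psi : torus R X -> torus R Y) :
  flow_equivalence psi -> exists (q : X -> torus R Y) (tau : X -> R) (delta : R),
    [/\ flow_section q tau, 0 < delta & forall x, delta <= tau x].
Proof.
move=> hpsi; have [n [d dP]] := flow_equivalence_step hpsi.
pose e : R := n.+1%:R^-1; pose q (x : X) := psi (torus_class x 0).
have e0 : 0 < e by rewrite invr_gt0 ltr0n.
have ne : n.+1%:R * e = 1 by rewrite mulfV// pnatr_eq0.
pose F (x : X) (i : nat) := d (torus_class x (i%:R * e)).
pose tau x := \sum_(i < n.+1) F x i.
have dcont := @step_continuous R X Y psi hpsi e d _.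
have {}dcont : forall (x : X) (t eps : R), 0 < eps ->
    exists (r : nat) (del : R), 0 < del /\
    forall (x1 : X) (t1 : R), agree r (val x) (val x1) -> `|t1 - t| < del ->
      `|d (torus_class x1 t1) - d (torus_class x t)| < eps.
  by apply: dcont => p; have [] := dP p.
(* A positive continuous function on a compact torus is bounded below. The bound also makes the
   partial sums of advances exceed any given time. *)
have [N NP] : exists N, forall n q, (N <= n)%N -> n.+1%:R^-1 < d q.
  apply: torus_compact_induction => x t; have [d0 _ _ _] := dP (torus_class x t).
  have d02 : 0 < d (torus_class x t) / 2 by lra.
  have [r [del [del0 delP]]] := dcont x t _ d02.
  exists r, del, (Num.truncn (d (torus_class x t) / 2)^-1); split => //.
  move=> m x1 t1 Nm xx1 tt1.
  have : m.+1%:R^-1 < d (torus_class x t) / 2.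
    rewrite invf_plt ?posrE ?ltr0n//; apply: lt_le_trans (truncnS_gt _) _.
    by rewrite ler_nat.
  move=> /lt_trans; apply; have := delP x1 t1 xx1 tt1.
  by rewrite ltr_norml => /andP[? ?]; lra.
have dmin p : N.+1%:R^-1 < d p by exact: NP.
have F0 x i : 0 < F x i by have [] := dP (torus_class x (i%:R * e)).
have FS x i : F x (n.+1 + i) = F (sh 1 x) i.
  by rewrite /F torus_class_sh natrD mulrDl ne addrC.
have sumS x k : \sum_(i < n.+1 * k) F x i = \sum_(i < k) tau (sh i%:Z x).
  elim: k x => [|k IH] x; first by rewrite muln0 !big_ord0.
  rewrite mulnS big_ord_addn [RHS]big_ord_recl /= sh0; congr (_ + _).
  under eq_bigr do rewrite FS.
  rewrite IH; apply: eq_bigr => i _; rewrite shD; congr (tau (sh _ x)).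
  by rewrite /= /bump /=; lia.
have path x k : psi (torus_class x (k%:R * e)) = flow (\sum_(i < k) F x i) (q x).
  elim: k => [|k IH]; first by rewrite big_ord0 flow0 mul0r.
  rewrite -natr1 mulrDl mul1r -flowE; have [_ _ -> _] := dP (torus_class x (k%:R * e)).
  by rewrite IH flowD big_ord_recr /= addrC.
exists q, tau, N.+1%:R^-1; split; last 2 first.
- by rewrite invr_gt0 ltr0n.
- move=> x; rewrite /tau big_ord_recl; apply: ler_wpDr.
    by apply: sumr_ge0 => i _; exact: ltW.
  exact/ltW/dmin.
split.
- move=> x0 y t k eps eps0 qE.
  have [r [del [del0 delP]]] := flow_equivalence_near hpsi k eps0 qE.
  by exists r => x x0x; apply: delP; rewrite ?subrr ?normr0.
- apply: (@real_local_sum X n.+1 (fun i x => F x i)) => i x0 eps eps0.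
  have [r [del [del0 delP]]] := dcont x0 (i%:R * e) eps eps0.
  by exists r => x x0x; apply: delP; rewrite ?subrr ?normr0.
- move=> x; rewrite /q torus_class_sh add0r -[1%:~R]ne path.
  by [].
- move=> w; have [[_ [phi [_ _ phiK]]] _] := hpsi.
  have [x [s [wE s0 _]]] := torus_fundP (phi w).
  have [b b0 bE] := flow_equivalence_forward hpsi (torus_class x 0) s0.
  by exists x, b; split=> //; rewrite -[LHS]phiK wE -bE flowE add0r.
move=> x x' b b0 qE.
have [K bK] : exists K, b < \sum_(i < K) F x i.
  exists (Num.truncn (b * N.+1%:R)).+1.
  have : b < (Num.truncn (b * N.+1%:R)).+1%:R / N.+1%:R.
    by rewrite ltr_pdivlMr ?ltr0n// truncnS_gt.
  move=> /lt_le_trans; apply; rewrite mulr_natl.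
  rewrite -[X in _ *+ X <= _]card_ord -sumr_const.
  by apply: ler_sum => i _; exact/ltW/dmin.
have [k [kb bk]] := partial_sum_bracket b0 bK.
have [_ _ _ /(_ (b - \sum_(i < k) F x i))] := dP (torus_class x (k%:R * e)).
case; [lra|by rewrite -/(F x k); lra|] => s [s0 se psiE sb].
move: psiE; rewrite flowE path flowD subrK -qE => /(flow_equivalence_inj hpsi).
move=> /torus_classE[m [mE x'E]]; rewrite add0r in mE.
have m0 : (0 <= m)%R.
  by rewrite -(ler_int R) -mE addr_ge0// mulr_ge0// ltW.
case: m m0 mE x'E => // m _ mE x'E; exists m; split => //.
(* [k] full steps and a remainder [s] shorter than a step add up to the integer [m]; hence the
   remainder vanishes and [k] is a multiple of n+1. *)
have kE : k = (n.+1 * m)%N.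
  have : k%:R + s * n.+1%:R = (n.+1 * m)%:R :> R.
    rewrite natrM -[m%:R]/((m%:Z)%:~R) -mE mulrDr mulrCA ne mulr1 mulrC.
    by rewrite [_ * s]mulrC.
  move=> E; have s1 : s * n.+1%:R < 1 by rewrite -ltr_pdivlMr ?ltr0n// mul1r.
  have s2 : 0 <= s * n.+1%:R by rewrite mulr_ge0.
  apply/eqP; rewrite eqn_leq -(ler_nat R) -ltnS -(ltr_nat R) -natr1.
  by apply/andP; split; lra.
have s00 : s = 0.
  move: mE; rewrite kE natrM mulrAC ne mul1r -[(Posz m)%:~R]/(m%:R); lra.
by have := sb s00; rewrite kE sumS; lra.
Qed.

End FlowSection.

(** * Stretching and rounding a cross-section *)

Section Rounding.
Variables (R : realType) (X Y : shift_space).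

(** Expanding every symbol is a tower of constant height 2, whose torus map doubles all times and so
    carries a section to one with doubled return times. *)
Lemma double_section (q : X -> torus R Y) (tau : X -> R) : flow_section q tau ->
  flow_section (tower_torus (@expand_point Y predT) (expand_height predT) \o q)
    (fun x => 2 * tau x).
Proof.
move=> qs; have ht := @expand_tower Y predT; set T := tower_torus _ _.
have height2 y : @expand_height Y predT y = 2%N by rewrite /expand_height size_tilde.
have TE y t : T (torus_class y t) = torus_class (expand_point predT y) (2 * t).
  rewrite /T (tower_timeE ht) /tower_time height2; congr torus_class.
  have -> : tower_sum (@expand_height Y predT) y (Num.floor t) = 2 * Num.floor t.
    case: (Num.floor t) => n /=.
      by rewrite (eq_bigr (fun=> 2%N)) // sum_nat_const card_ord; lia.
    by rewrite (eq_bigr (fun=> 2%N)) // sum_nat_const card_ord NegzE; lia.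
  by rewrite intrM mulrBr addrC subrK.
have Tflow b w : T (flow b w) = flow (2 * b) (T w).
  by have [y [t ->]] := torusP w; rewrite flowE !TE flowE mulrDr.
split.
- move=> x0 y t k e e0 /= qE; have [y0 [t0 q0]] := torusP (q x0).
  have := qE; rewrite q0 TE => /torus_classE[n [tE yE]].
  have e2 : 0 < e / 2 by lra.
  have [m mP] := local_code_agree k (local_code_comp (tower_code ht) (local_code_sh n)).
  have [r rP] := section_near qs m e2 q0; exists r => x /rP[y1 [t1 [-> yy1 tt1]]].
  exists (sh n (expand_point predT y1)), (2 * t1 - n%:~R); split.
  + by rewrite TE torus_class_sh subrK.
  + by rewrite yE; exact: mP.
  + by move: tt1; rewrite !ltr_norml => /andP[? ?]; apply/andP; lra.
- move=> x0 e e0; have e2 : 0 < e / 2 by lra.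
  have [r rP] := section_time qs x0 e2; exists r => x /rP.
  by rewrite !ltr_norml => /andP[? ?]; apply/andP; lra.
- by move=> x /=; rewrite (section_return qs) Tflow.
- move=> w; have [p <-] := tower_torus_surj ht w.
  have [x [b [b0 ->]]] := section_surj qs p.
  by exists x, (2 * b); split; [lra|rewrite /= -Tflow].
- move=> x x' b b0 /= E.
  have [||k [x'E bE]] := @section_inj _ _ _ _ _ qs x x' (b / 2); first by lra.
    by apply: (tower_torus_inj ht); rewrite -/T Tflow [2 * _]mulrC divfK.
  by exists k; split=> //; rewrite -mulr_sumr -bE mulrC divfK.
Qed.

(* The cross-section is moved along the flow by the locally chosen time [rho]
   into Y x {0}. As |rho (sigma x) - rho x| < 3/2 and the return times exceed 2,
   the moved points are still visited in the same order. *)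
Lemma section_tower (q : X -> torus R Y) (tau : X -> R) :
  flow_section q tau -> (forall x, 2 < tau x) ->
  exists (h : X -> Y) (r : X -> nat), tower h r.
Proof.
move=> qs tau2.
have [rep repP] : exists rep : X -> Y * R, forall z,
    [/\ q z = torus_class (rep z).1 (rep z).2, 0 <= (rep z).2 & (rep z).2 < 1].
  have repP z : exists p : Y * R, [/\ q z = torus_class p.1 p.2, 0 <= p.2 & p.2 < 1].
    by have [y [t ?]] := torus_fundP (q z); exists (y, t).
  by have [rep ?] := choice repP; exists rep.
have [N NP] : exists N, forall n x, (N <= n)%N -> forall x', agree n (val x) (val x') ->
    exists y t y' t', [/\ q x = torus_class y t, q x' = torus_class y' t' &
      `|t' - t| < 1 / 4].
  apply: points_compact_induction => x0; have [qE _ _] := repP x0.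
  have e0 : 0 < 1 / 8 :> R by lra.
  have [r rP] := section_near qs 0 e0 qE; exists r, r => n x rn x0x x' xx'.
  have [y [t [? _ tt]]] := rP _ x0x.
  have [|y' [t' [? _ tt']]] := rP x'.
    by apply: agree_trans x0x _; apply: agreeW xx'.
  exists y, t, y', t'; split => //; move: tt tt'; rewrite !ltr_norml.
  by move=> /andP[? ?] /andP[? ?]; apply/andP; lra.
(* One model point per block of radius [N]: the reference lift at [x] is that of its model, hence
   locally constant in [x]. *)
have [G GP] : exists G : blocks X (N + N).+1 -> X,
    forall b, word (val (G b)) (- N%:Z) (N + N).+1 = val b.
  have GP (b : blocks X (N + N).+1) : exists x : X,
      word (val x) (- N%:Z) (N + N).+1 = val b.
    have [x [i ->]] := set_mem (valP b); exists (sh (i + N%:Z) x).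
    by apply/eq_wordP => k _; rewrite /= /shiftn; congr (val x _); lia.
  by have [G ?] := choice GP; exists G.
pose code (x : X) := G (block_at (N + N).+1 x (- N%:Z)).
have codeP x : agree N (val (code x)) (val x).
  move=> i iN; have /eq_wordP/(_ (absz (i + N%:Z))) := GP (block_at (N + N).+1 x (- N%:Z)).
  rewrite (_ : (- N%:Z + (absz (i + N%:Z)%R)%:Z)%R = i); last by lia.
  by move=> ->//; lia.
have code_agree x x' : agree N (val x) (val x') -> code x' = code x.
  move=> xx'; congr G; apply: val_inj => /=; apply/eq_wordP => k kN.
  by apply: xx'; lia.
have [hr hrP] : exists hr : X -> Y * R, forall x,
    q x = torus_class (hr x).1 (hr x).2 /\ `|(hr x).2 - (rep (code x)).2| < 1 / 4.
  suff hrP x : exists p : Y * R,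
      q x = torus_class p.1 p.2 /\ `|p.2 - (rep (code x)).2| < 1 / 4.
    by have [hr ?] := choice hrP; exists hr.
  have [y [t [y' [t' [qz qx tt']]]]] := NP N (code x) (leqnn _) x (codeP x).
  have [+ _ _] := repP (code x); rewrite qz => /torus_classE[n [tE _]].
  exists (sh n y', t' - n%:~R); rewrite /= torus_class_sh subrK; split => //.
  by move: tt'; rewrite tE !ltr_norml => /andP[? ?]; apply/andP; lra.
pose h x := (hr x).1; pose rho x := (hr x).2.
have qE x : q x = torus_class (h x) (rho x) by have [] := hrP x.
have rho_bounds x : - (1 / 4) < rho x /\ rho x < 5 / 4.
  have [_] := hrP x; have [_ ? ?] := repP (code x); rewrite ltr_norml /rho => /andP[? ?].
  by split; lra.
have hr_near (x0 : X) (k : nat) (e : R) : 0 < e -> exists r, forall x : X,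
    agree r (val x0) (val x) ->
    agree k (val (h x0)) (val (h x)) /\ `|rho x - rho x0| < e.
  move=> e0; pose e1 := Num.min e (1 / 4).
  have e10 : 0 < e1 by rewrite lt_min e0; lra.
  have [r rP] := section_near qs k e10 (qE x0).
  exists (N + r)%N => x x0x.
  have [|y1 [t1 [qx hy tt]]] := rP x; first by apply: agreeW x0x; lia.
  have codeE : code x = code x0 by apply: code_agree; apply: agreeW x0x; lia.
  move: qx; rewrite qE => /torus_classE[n [nE hE]].
  (* Both rounding times are within 1/4 of the same reference, so the nearby lift and the chosen one
     cannot differ by a nonzero integer. *)
  have [_] := hrP x; have [_] := hrP x0; rewrite codeE -!/(rho _).
  move: tt; rewrite lt_min => /andP[tt1 tt2].
  move: (tt2); rewrite !ltr_norml => /andP[? ?] /andP[? ?] /andP[? ?].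
  have n0 : n = 0 by apply: (@int_eq0 R); rewrite ltr_norml; apply/andP; lra.
  move: nE hE; rewrite n0 addr0 sh0 => nE hE; split; first by rewrite -hE.
  by rewrite nE -ltr_norml.
have rP x : exists r : nat, rho x + tau x = rho (sh 1 x) + r%:R /\
    h (sh 1 x) = sh r%:Z (h x).
  have := section_return qs x; rewrite !qE flowE => /esym/torus_classE[n [nE hE]].
  have n0 : (0 <= n)%R.
    rewrite -(ler_int R); have [? ?] := rho_bounds x.
    have [? ?] := rho_bounds (sh 1 x); have := tau2 x; lra.
  by case: n n0 nE hE => // r _ nE hE; exists r.
have [r {}rP] := choice rP.
have r_gt0 x : (0 < r x)%N.
  rewrite -(ltr_nat R); have [? _] := rP x; have [? ?] := rho_bounds x.
  by have [? ?] := rho_bounds (sh 1 x); have := tau2 x; lra.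
(* The corrections by [rho] telescope, so heights and return times add up to the same total up to
   the two end corrections. *)
have sum_r x k : (\sum_(i < k) r (sh i%:Z x))%N%:R =
    \sum_(i < k) tau (sh i%:Z x) + rho x - rho (sh k%:Z x).
  elim: k => [|k IH]; first by rewrite !big_ord0 sh0 add0r subrr.
  rewrite !big_ord_recr /= natrD IH.
  have [+ _] := rP (sh k%:Z x); rewrite shD (_ : 1 + k%:Z = k.+1%:Z); last by lia.
  lra.
exists h, r; split.
- move=> j x0; have [m mP] := hr_near x0 (absz j) 1 ltr01.
  by exists m => x /mP[E _]; exact: E.
- move=> x0; have e0 : 0 < 1 / 4 :> R by lra.
  have [m1 mP1] := hr_near x0 0%N _ e0; have [m2 mP2] := hr_near (sh 1 x0) 0%N _ e0.
  have [m3 mP3] := section_time qs x0 e0.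
  exists (m1 + m2 + m3 + 1)%N => x x0x.
  have [|_ d1] := mP1 x; first by apply: agreeW x0x; lia.
  have [|_ d2] := mP2 (sh 1 x); first by apply: agree_shiftn; apply: agreeW x0x; lia.
  have d3 : `|tau x - tau x0| < 1 / 4 by apply: mP3; apply: agreeW x0x; lia.
  have [rx _] := rP x; have [rx0 _] := rP x0.
  have : (r x)%:Z - (r x0)%:Z = 0.
    apply: (@int_eq0 R); rewrite intrB -[(Posz (r x))%:~R]/((r x)%:R).
    rewrite -[(Posz (r x0))%:~R]/((r x0)%:R).
    move: d1 d2 d3; rewrite !ltr_norml => /andP[? ?] /andP[? ?] /andP[? ?].
    by apply/andP; lra.
  lia.
- exact: r_gt0.
- by move=> x; have [] := rP x.
- move=> w.
  have reduce (j : nat) : forall x, exists x' (j' : nat), (j' < r x')%N /\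
      sh j%:Z (h x) = sh j'%:Z (h x').
    elim/ltn_ind: j => j IH x; have [jx|xj] := ltnP j (r x); first by exists x, j.
    have [|x' [j' [? E]]] := IH (j - r x)%N _ (sh 1 x).
      by have := r_gt0 x; lia.
    exists x', j'; split => //; rewrite -E; have [_ ->] := rP x.
    by rewrite shD; congr sh; lia.
  have [x [b [b0]]] := section_surj qs (torus_class w 0).
  rewrite qE flowE => /esym/torus_classE[n [nE ->]].
  have n0 : (0 <= n)%R.
    have [? ?] := rho_bounds x; have : -1 < n%:~R :> R by lra.
    by rewrite -[-1]/((-1)%:~R) ltr_int; lia.
  by case: n n0 nE => // j _ _; exact: reduce.
(* The last hypothesis concerns the flow time from [q x] to [q x']. It may be assumed nonnegative by
   exchanging the two points, and then [section_inj] applies. *)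
suff main x x' (j j' : nat) : (j < r x)%N -> (j' < r x')%N ->
    sh j%:Z (h x) = sh j'%:Z (h x') -> 0 <= rho x' - rho x + j%:R - j'%:R ->
    x = x' /\ j = j'.
  move=> x x' j j' jx jx' E.
  have [le|lt] := leP 0 (rho x' - rho x + j%:R - j'%:R); first exact: main.
  by have [||||-> ->] := main x' x j' j => //; lra.
move=> jx jx' E b0.
have := @section_inj _ _ _ _ _ qs x x' _ b0; case.
  rewrite !qE flowE -[h x'](@shK Y j'%:Z) -E shD torus_class_sh; congr torus_class.
  rewrite rmorphD rmorphN /= -[(Posz j)%:~R]/(j%:R) -[(Posz j')%:~R]/(j'%:R); lra.
move=> k [x'E bE]; have := sum_r x k; rewrite -x'E -bE => sumE.
case: k x'E bE sumE => [|k] x'E bE sumE.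
  move: x'E sumE; rewrite big_ord0 sh0 => -> sumE; split=> //; apply/eqP.
  by rewrite -(eqr_nat R); apply/eqP; lra.
(* With at least one return in between, the telescoped sum puts [j] at or above [r x], which is
   impossible. *)
have : (r x)%:R + j'%:R <= j%:R :> R.
  have : (r x)%:R <= (\sum_(i < k.+1) r (sh i%:Z x))%:R :> R.
    by rewrite ler_nat big_ord_recl /= sh0 leq_addr.
  lra.
by rewrite -natrD ler_nat; lia.
Qed.
End Rounding.

(** Each doubling is itself a tower, so [cover_tower] controls the covers while return times grow
    geometrically. The target [Y] and its section are generalized because they change at every
    doubling. *)
Lemma section_stretch (R : realType) (c : shift_cover) (X : shift_space)
    (m : nat) :
  canonical_cover c -> respects_symbol_expansion c ->
  forall (Y : shift_space) (q : X -> torus R Y) (tau : X -> R) (delta : R),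
  irreducible_sofic Y -> flow_section q tau -> (forall x, delta <= tau x) ->
  exists (Y' : shift_space) (q' : X -> torus R Y') (tau' : X -> R),
    [/\ flow_section q' tau',
        orbit_equivalent_codes R (cover_map c Y) (cover_map c Y') &
        forall x, 2 ^+ m.+1 * delta <= tau' x].
Proof.
move=> hcan hexp; elim: m => [|m IH] Y q tau delta iY qs tauP;
  have [iY' oe] := cover_tower R hcan hexp iY (@expand_tower Y predT);
  have qs' := double_section qs.
  exists (symbol_expansion Y predT),
    (tower_torus (@expand_point Y predT) (expand_height predT) \o q),
    (fun x => 2 * tau x).
  split; [exact: qs'|exact: oe|] => x.
  by have := tauP x; rewrite expr1; lra.
have [|Y'' [q'' [tau'' [qs'' oe' tau''P]]]] := IH _ _ _ (2 * delta) iY' qs'.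
  by move=> x; have := tauP x; lra.
exists Y'', q'', tau''; split => // [|x]; last by rewrite exprSr -mulrA.
exact: orbit_equivalent_codes_trans oe oe'.
Qed.

Theorem theorem3p3 (R : realType) (c : shift_cover)
    (hcanonical : canonical_cover c) (hexpansion : respects_symbol_expansion c)
    (X1 X2 : shift_space)
    (hX1 : irreducible_sofic X1) (hX2 : irreducible_sofic X2)
    (hflow : flow_equivalent R X1 X2) :
  flow_equivalent_codes R (cover_map c X1) (cover_map c X2).
Proof.
have [psi /flow_equivalence_section[q [tau [delta [qs delta0 tauP]]]]] := hflow.
(* This suffices because [2 / delta < m.+1 <= 2 ^ m.+1]. *)
pose m := Num.truncn (2 / delta).
have [Y [q' [tau' [qs' oe2 tauP']]]] :=
  section_stretch m hcanonical hexpansion hX2 qs tauP.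
have tau2 x : 2 < tau' x.
  apply: lt_le_trans (tauP' x); rewrite -ltr_pdivrMr//.
  apply: lt_le_trans (truncnS_gt _) _; rewrite -/m -natrX ler_nat.
  exact/ltnW/ltn_expl.
have [h [r hr]] := section_tower qs' tau2.
have [_ oe1] := cover_tower R hcanonical hexpansion hX1 hr.
apply: orbit_equivalent_codes_flow; apply: orbit_equivalent_codes_trans oe1 _.
exact: orbit_equivalent_codes_sym.
Qed.
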